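(* The tuple $(K[\mathcal{T}[\infty]],\star,\Delta_{\mathrm s})$ is a graded Hopf algebra; in particular $\star$ is associative and $\Delta_{\mathrm s}(t\star w)=\Delta_{\mathrm s}(t)\star\Delta_{\mathrm s}(w)$ for all $t,w\in\mathcal{T}[\infty]$.
   Context: $K$ is a field. A tree is a finite planar rooted tree, degree = number of non-root nodes, $\odot$ the one-node tree. An $n$--tree is a tree of degree $n$ whose non-root nodes are labelled bijectively by $\{1,\dots,n\}$; $\mathcal{T}[\infty]$ is the set of all $n$--trees, $K[\mathcal{T}[\infty]]$ the vector space with basis $\mathcal{T}[\infty]$. Nodes $N(t)$ are ordered by depth-first post-order (subtrees left to right recursively, then the node; root maximal); write $u_1<\dots<u_n$ for non-root nodes. For a set $A$ of non-root nodes, $t_A$ is obtained by deleting non-root nodes outside $A$ (children attached in order to the parent in place of the deleted node), labels kept; $t_{[i,j]}=t_{\{u_h,\dots,u_k\}}$ if $i\le j$ and $[i,j]\cap[n]=[h,k]\ne\emptyset$, else $\odot$. Standardization $\mathrm s(t)$ of an $\mathbb N$-labelled tree with distinct labels relabels by $1,\dots,|t|$ preserving relative order. $\Delta_{\mathrm s}(t)=\sum_{k=0}^n\mathrm s(t_{[1,k]})\otimes\mathrm s(t_{[k+1,n]})$. The $m$--shift $w[m]$ adds $m$ to every label. For labelled trees: a partition of $u$ of degree $n\ge1$ is an ordered tuple $(u_{[n_0+1,n_1]},\dots,u_{[n_{k-1}+1,n_k]})$, $0=n_0<\dots<n_k=n$; for $P=(u_1,\dots,u_k)$, $I(P,t)$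 is the set of maps $f$ from blocks to $N(t)$ with $f(u_1)<\dots<f(u_k)$; $t\#_{P,f}u$ identifies the root of each $u_i$ with $f(u_i)$, the root-children of $u_i$ becoming children of $f(u_i)$ to the right of its original children, all labels kept; $t* u=\sum_{P,f}t\#_{P,f}u$ ($|u|\ge1$), $t*\odot=t$. The star product is $t\star w=t* w[m]$ for $|t|=m$, extended bilinearly. *)

(* Defs.v *)
From HB Require Import structures.
From mathcomp Require Import all_boot all_order all_algebra.
Set Implicit Arguments. Unset Strict Implicit. Unset Printing Implicit Defensive.
Import GRing.Theory.

(* Planar rooted trees.  A tree is represented by the (ordered) forest  *)
(* of the subtrees hanging from its (unlabelled) root; every non-root   *)
(* node carries a natural-number label.  The one-node tree ⊙ is [::].   *)
Inductive ntree := NT of nat & seq ntree.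
Definition forest := seq ntree.

Fixpoint ntree_enc (x : ntree) : GenTree.tree unit :=
  let: NT l cs := x in GenTree.Node l (map ntree_enc cs).
Fixpoint ntree_dec (t : GenTree.tree unit) : ntree :=
  match t with
  | GenTree.Leaf _ => NT 0 [::]
  | GenTree.Node l ts => NT l (map ntree_dec ts)
  end.
Fixpoint ntree_encK (x : ntree) : ntree_dec (ntree_enc x) = x :=
  match x return ntree_dec (ntree_enc x) = x with
  | NT l cs => congr1 (NT l)
      ((fix loop (cs : seq ntree) : map ntree_dec (map ntree_enc cs) = cs :=
          match cs return map ntree_dec (map ntree_enc cs) = cs with
          | [::] => erefl
          | c :: cs' => f_equal2 cons (ntree_encK c) (loop cs')
          end) cs)
  end.
HB.instance Definition _ := Countable.copy ntree (can_type ntree_encK).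

Fixpoint nsize (x : ntree) : nat := let: NT _ cs := x in (sumn (map nsize cs)).+1.
Definition fsize (f : forest) : nat := sumn (map nsize f).

Fixpoint nlabels (x : ntree) : seq nat :=
  let: NT l cs := x in flatten (map nlabels cs) ++ [:: l].
Definition flabels (f : forest) : seq nat := flatten (map nlabels f).

Fixpoint nrelabel (g : nat -> nat) (x : ntree) : ntree :=
  let: NT l cs := x in NT (g l) (map (nrelabel g) cs).
Definition frelabel (g : nat -> nat) (f : forest) : forest := map (nrelabel g) f.

Definition ntreeb (t : forest) : bool := perm_eq (flabels t) (iota 1 (fsize t)).

(* Restriction t_A.  Non-root nodes are identified with their 0-based    *)
(* position in post-order (position p is the node u_(p+1)).  Nodes whose *)
(* position fails P are deleted, their children being attached in order  *)
(* to the parent in place of the deleted node.                          *)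
Fixpoint nrestr (P : pred nat) (o : nat) (x : ntree) : forest :=
  let: NT l cs := x in
  let cs' := (fix go (o : nat) (cs : seq ntree) : forest :=
               match cs with
               | [::] => [::]
               | c :: cs => nrestr P o c ++ go (o + nsize c) cs
               end) o cs in
  if P (o + fsize cs) then [:: NT l cs'] else cs'.
Fixpoint frestr_at (P : pred nat) (o : nat) (f : forest) : forest :=
  match f with
  | [::] => [::]
  | c :: f => nrestr P o c ++ frestr_at P (o + nsize c) f
  end.
Definition frestr (P : pred nat) (t : forest) : forest := frestr_at P 0 t.

(* t_[i,j] : keep the nodes u_h with i <= h <= j (this is ⊙ when i > j or *)
(* [i,j] does not meet [n]).                                              *)
Definition tint (i j : nat) (t : forest) : forest :=
  frestr (fun p => (i <= p.+1) && (p.+1 <= j)) t.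

Definition std (t : forest) : forest :=
  frelabel (fun l => count (fun x => x <= l) (flabels t)) t.

Definition shift (m : nat) (t : forest) : forest := frelabel (addn m) t.

(* Grafting: node at post-order position p (0-based) receives the forest  *)
(* g p as additional children to the right of its own; the root (position *)
(* fsize t) receives g (fsize t).                                         *)
Fixpoint ngraft (g : nat -> forest) (o : nat) (x : ntree) : ntree :=
  let: NT l cs := x in
  let cs' := (fix go (o : nat) (cs : seq ntree) : forest :=
               match cs with
               | [::] => [::]
               | c :: cs => ngraft g o c :: go (o + nsize c) cs
               end) o cs in
  NT l (cs' ++ g (o + fsize cs)).
Fixpoint fgraft_at (g : nat -> forest) (o : nat) (f : forest) : forest :=
  match f with
  | [::] => [::]
  | c :: f => ngraft g o c :: fgraft_at g (o + nsize c) f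
  end.
Definition fgraft (g : nat -> forest) (t : forest) : forest :=
  fgraft_at g 0 t ++ g (fsize t).

Fixpoint subseqs (T : Type) (s : seq T) : seq (seq T) :=
  match s with
  | [::] => [:: [::]]
  | x :: s' => let r := subseqs s' in [seq x :: y | y <- r] ++ r
  end.

(* blocks of the partition of u given by the cut points
   0 = n_0 < n_1 < ... < n_(k-1) < n_k = n, with cuts = [n_1; ..; n_(k-1)] *)
Definition blocks (n : nat) (cuts : seq nat) (u : forest) : seq forest :=
  pairmap (fun a b => tint a.+1 b u) 0 (rcons cuts n).

Definition gfun (bl : seq forest) (F : seq nat) (p : nat) : forest :=
  if p \in F then nth [::] bl (index p F) else [::].

(* t * u as a list of trees (with multiplicities): sum over partitions P of
   u and strictly increasing maps f from the blocks to N(t).              *)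
Definition star_list (t u : forest) : seq forest :=
  if u is [::] then [:: t] else
  let n := fsize u in
  flatten [seq [seq fgraft (gfun (blocks n C u) F) t
               | F <- [seq F <- subseqs (iota 0 (fsize t).+1) | size F == (size C).+1]]
          | C <- subseqs (iota 1 n.-1)].

Definition star (t w : forest) : seq forest := star_list t (shift (fsize t) w).

Definition cop (t : forest) : seq (forest * forest) :=
  let n := fsize t in
  [seq (std (tint 1 k t), std (tint k.+1 n t)) | k <- iota 0 n.+1].

(* Formal linear combinations: a vector of K[X] is a list of            *)
(* (coefficient, basis element) pairs, compared through coefficients.   *)
Section Vec.
Variable K : fieldType.
Local Open Scope ring_scope.

Definition coef (T : eqType) (v : seq (K * T)) (x : T) : K :=
  \sum_(p <- v | p.2 == x) p.1.
Definition veq (T : eqType) (v w : seq (K * T)) : Prop :=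
  forall x, coef v x = coef w x.

Definition tb (t : forest) : seq (K * forest) := [:: (1, t)].

Definition vstar (v w : seq (K * forest)) : seq (K * forest) :=
  flatten [seq [seq (p.1 * q.1, x) | x <- star p.2 q.2] | p <- v, q <- w].

Definition vcop (v : seq (K * forest)) : seq (K * (forest * forest)) :=
  flatten [seq [seq (p.1, x) | x <- cop p.2] | p <- v].

Definition tstar (v w : seq (K * (forest * forest))) : seq (K * (forest * forest)) :=
  flatten [seq [seq (p.1 * q.1, (x, y)) | x <- star p.2.1 q.2.1, y <- star p.2.2 q.2.2]
          | p <- v, q <- w].

Definition eps (t : forest) : K := (t == [::])%:R.

Definition cop_left (t : forest) : seq (K * (forest * forest * forest)) :=
  flatten [seq [seq (1, (y.1, y.2, x.2)) | y <- cop x.1] | x <- cop t].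
Definition cop_right (t : forest) : seq (K * (forest * forest * forest)) :=
  flatten [seq [seq (1, (x.1, y.1, y.2)) | y <- cop x.2] | x <- cop t].

Definition counit_r (t : forest) : seq (K * forest) := [seq (eps x.2, x.1) | x <- cop t].
Definition counit_l (t : forest) : seq (K * forest) := [seq (eps x.1, x.2) | x <- cop t].

Definition antip_l (S : forest -> seq (K * forest)) (t : forest) : seq (K * forest) :=
  flatten [seq vstar (S x.1) (tb x.2) | x <- cop t].
Definition antip_r (S : forest -> seq (K * forest)) (t : forest) : seq (K * forest) :=
  flatten [seq vstar (tb x.1) (S x.2) | x <- cop t].
End Vec.

(* Main.v *)
(* Write a forest in post-order and attach to each node its left boundary: the
   last node preceding its whole subtree (0 if there is none).  This word
   determines the forest.  The labels of a term of t * u form a shuffle of those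
   of t and u, each shuffle occurring once, and the boundary of a node l is the
   last node before l among the blockers of l: for a node of t, its boundary
   in t; for a node of u, its boundary in u and all the nodes of t.  Restricting
   a forest to an interval of nodes does not change the blockers.  Hence the two
   sides of associativity (resp. of the compatibility with the coproduct) are
   families of forests with the same blockers, indexed by the same words by
   associativity (resp. deconcatenation) of shuffles.  The antipode is obtained
   by recursion on the degree as a left and as a right convolution inverse of
   the identity; the two coincide by associativity and coassociativity. *)
Require Import Defs.
From HB Require Import structures.
From mathcomp Require Import all_boot all_order all_algebra.
From mathcomp Require Import zify.
Import GRing.Theory.

Set Implicit Arguments.
Unset Strict Implicit.
Unset Printing Implicit Defensive.

(** * Post-order codes *)

(** Induction as on binary trees: the children of the first root on one side, the trees to its right
    on the other. This supplies the hypothesis on children that the generated principle of the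
    nested type [ntree] lacks. *)
Lemma forest_ind (P : forest -> Prop) :
  P [::] -> (forall l cs f, P cs -> P f -> P (NT l cs :: f)) -> forall f, P f.
Proof.
move=> P0 PS.
have PT : forall x : ntree, let: NT _ cs := x in P cs.
  fix IH 1; case=> l; elim=> [//|c f Pf].
  by case: c (IH c) => l' cs' Pc; exact: PS.
by elim=> [//|[l cs] f Pf]; apply: PS => //; exact: (PT (NT l cs)).
Qed.

Fixpoint ncode (x : nat) (t : ntree) : seq (nat * nat) :=
  let: NT l cs := t in
  (fix go x cs := if cs is c :: cs' then
     ncode x c ++ go (let: NT l' _ := c in l') cs' else [::]) x cs ++ [:: (l, x)].

(* Post-order word of a forest: each node comes with its left boundary, the
   label of the last node preceding its whole subtree ([x] if there is none). *)
Fixpoint fcode (x : nat) (f : forest) : seq (nat * nat) :=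
  if f is c :: f' then ncode x c ++ fcode (let: NT l _ := c in l) f' else [::].

(** The local fixpoint of [ncode] computes [fcode] itself and only serves the guard condition; this
    equation hides it. The root and its first child share the boundary [x], and the next sibling
    starts from [l]. *)
Lemma fcode_cons x l cs f :
  fcode x (NT l cs :: f) = fcode x cs ++ (l, x) :: fcode l f.
Proof.
rewrite /= -catA /=; set r := (fix go (x : nat) (cs : seq ntree) {struct cs} : seq (nat * nat) := _).
have -> // : r x cs = fcode x cs by elim: cs x => //= c cs IH x; rewrite IH.
Qed.

Lemma fsize_cons l cs f : fsize (NT l cs :: f) = fsize cs + (fsize f).+1.
Proof. by rewrite /fsize /= addSn addnS. Qed.

Lemma flabels_cons l cs f : flabels (NT l cs :: f) = flabels cs ++ l :: flabels f.
Proof. by rewrite /flabels /= -catA. Qed.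

Lemma frestr_cons P o l cs f :
  frestr_at P o (NT l cs :: f) =
  (if P (o + fsize cs) then [:: NT l (frestr_at P o cs)] else frestr_at P o cs)
  ++ frestr_at P (o + fsize cs).+1 f.
Proof.
rewrite /= -addnS; set r := (fix go (o : nat) (cs : seq ntree) {struct cs} : forest := _).
have -> // : r o cs = frestr_at P o cs by elim: cs o => //= c cs IH o; rewrite IH.
Qed.

Lemma fgraft_cons g o l cs f :
  fgraft_at g o (NT l cs :: f) =
  NT l (fgraft_at g o cs ++ g (o + fsize cs)) :: fgraft_at g (o + fsize cs).+1 f.
Proof.
rewrite /= -addnS; set r := (fix go (o : nat) (cs : seq ntree) {struct cs} : forest := _).
have -> // : r o cs = fgraft_at g o cs by elim: cs o => //= c cs IH o; rewrite IH.
Qed.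

Lemma frelabel_cons g l cs f :
  frelabel g (NT l cs :: f) = NT (g l) (frelabel g cs) :: frelabel g f.
Proof. by []. Qed.

Lemma flabels_cat f g : flabels (f ++ g) = flabels f ++ flabels g.
Proof. by rewrite /flabels map_cat flatten_cat. Qed.

Lemma unzip1_fcode x f : unzip1 (fcode x f) = flabels f.
Proof.
elim/forest_ind: f x => // l cs f IH1 IH2 x.
by rewrite fcode_cons flabels_cons /unzip1 map_cat /= -/(unzip1 _) IH1 -/(unzip1 _) IH2.
Qed.

Lemma size_flabels f : size (flabels f) = fsize f.
Proof.
elim/forest_ind: f => // l cs f IH1 IH2.
by rewrite flabels_cons fsize_cons size_cat /= IH1 IH2.
Qed.

Lemma fsize_eq0 f : (fsize f == 0) = (f == [::]).
Proof. by case: f => // -[l cs] f; rewrite fsize_cons addnS. Qed.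

Lemma fcode_cat x f g : fcode x (f ++ g) = fcode x f ++ fcode (last x (flabels f)) g.
Proof.
elim: f x => //= -[l cs] f IH x.
by rewrite IH flabels_cons last_cat /= catA.
Qed.

Lemma fcode_bound x f p : p \in fcode x f -> p.2 \in x :: flabels f.
Proof.
elim/forest_ind: f x => // l cs f IH1 IH2 x.
rewrite fcode_cons flabels_cons mem_cat !inE => /or3P[/IH1|/eqP->|/IH2];
  rewrite ?inE ?mem_cat ?inE ?eqxx //; last by case/orP=> ->; rewrite ?orbT.
by case/orP=> ->; rewrite ?orbT.
Qed.

(* In the code of [NT l cs :: f] the root [l] is the last letter with left
   boundary [x], so the code can be split uniquely. *)
Lemma fcode_inj (x : nat) f g : uniq (flabels f) -> x \notin flabels f ->
  fcode x f = fcode x g -> f = g.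
Proof.
elim/forest_ind: f x g => [x [|[l cs] g] _ _|l cs f IH1 IH2 x [|[l' cs'] g]] //.
- by rewrite fcode_cons; case: (fcode x cs).
- by rewrite fcode_cons; case: (fcode x cs).
move=> uf xf e; have ef : flabels (NT l cs :: f) = flabels (NT l' cs' :: g).
  by rewrite -!(unzip1_fcode x) e.
(* Behind the first root, every boundary is that root or a label of the trees to its right, hence
   never [x]. *)
have nb (l1 : nat) cs1 f1 : uniq (flabels (NT l1 cs1 :: f1)) -> x \notin flabels (NT l1 cs1 :: f1) ->
    all (fun p => p.2 != x) (fcode l1 f1).
  rewrite flabels_cons mem_cat inE !negb_or => _ /and3P[_ xl xf1].
  apply/allP=> p /fcode_bound; rewrite inE => /orP[/eqP->|]; first by rewrite eq_sym.
  by apply: contraTneq => ->.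
have [n1 n2] : all (fun p => p.2 != x) (fcode l f) /\ all (fun p => p.2 != x) (fcode l' g).
  by split; [apply: nb uf xf | apply: (nb _ cs'); rewrite -ef].
move: e; rewrite !fcode_cons => e.
have E : forall a a' b b' (p p' : nat * nat), all (fun p => p.2 != x) b ->
   all (fun p => p.2 != x) b' -> p.2 = x -> p'.2 = x ->
   a ++ p :: b = a' ++ p' :: b' -> [/\ a = a', p = p' & b = b'].
  elim=> [|q a IH] [|q' a'] b b' p p' hb hb' hp hp' /= [].
  - by move=> -> ->.
  - by move=> _ eb; move: hb; rewrite eb all_cat /= hp' eqxx andbF.
  - by move=> _ eb; move: hb'; rewrite -eb all_cat /= hp eqxx andbF.
  by move=> -> /(IH _ _ _ _ _ hb hb' hp hp')[-> -> ->].
have [e1 [el] e2] := E _ _ _ _ (l, x) (l', x) n1 n2 erefl erefl e.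
move: uf xf; rewrite flabels_cons cat_uniq mem_cat inE !negb_or /=.
case/and3P=> uc _ /andP[lf uf] /and3P[xc _ xf]; subst l'.
by rewrite (IH1 _ _ uc xc e1) (IH2 _ _ uf lf e2).
Qed.

(* [Q l] is the set of blockers of [l], [e] the nodes already read. *)
Fixpoint mkcode (x : nat) (Q : nat -> pred nat) (e s : seq nat) : seq (nat * nat) :=
  if s is l :: s' then (l, last x (filter (Q l) e)) :: mkcode x Q (rcons e l) s' else [::].

Lemma unzip1_mkcode x Q e s : unzip1 (mkcode x Q e s) = s.
Proof. by elim: s e => //= l s IH e; rewrite IH. Qed.

Lemma mkcode_cat x Q e s1 s2 :
  mkcode x Q e (s1 ++ s2) = mkcode x Q e s1 ++ mkcode x Q (e ++ s1) s2.
Proof. by elim: s1 e => [|l s1 IH] e /=; rewrite ?cats0 // IH -cat_rcons. Qed.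

Lemma eq_mkcode x Q Q' e s :
  (forall l, l \in s -> {in e ++ s, Q l =1 Q' l}) -> mkcode x Q e s = mkcode x Q' e s.
Proof.
elim: s e => //= l s IH e H; rewrite IH.
  by congr (_ :: _); congr (_, last _ _); apply: eq_in_filter => y ye;
    apply: H; rewrite ?inE ?eqxx // mem_cat ye.
by move=> k ks y; rewrite cat_rcons => ye; apply: H; rewrite // inE ks orbT.
Qed.

Definition fshape (t : forest) (Q : nat -> pred nat) : Prop :=
  fcode 0 t = mkcode 0 Q [::] (flabels t).

(** 0 is reserved as the boundary of a node whose subtree is preceded by nothing, so it must not be
    a label. *)
Definition good_labels (s : seq nat) : bool := uniq s && (0 \notin s).

(** The main tool for proving two forests equal: common blockers and the same post-order word of
    labels suffice. *)
Lemma fshape_inj t u Q : good_labels (flabels t) -> fshape t Q -> fshape u Q ->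
  flabels t = flabels u -> t = u.
Proof.
by case/andP=> ut t0 st su e; apply: (fcode_inj ut t0); rewrite st su e.
Qed.

(** A canonical choice of blockers: for a node of [t], its boundary alone, or 0, which no node
    bears, if nothing precedes its subtree. *)
Definition codeQ (t : forest) (l : nat) : pred nat := fun y => (l, y) \in fcode 0 t.

Fixpoint wfcode (S : pred nat) (w : seq (nat * nat)) : bool :=
  if w is p :: w' then S p.2 && wfcode (predU1 p.1 S) w' else true.

Lemma eq_wfcode S S' w : S =1 S' -> wfcode S w = wfcode S' w.
Proof. by elim: w S S' => //= p w IH S S' e; rewrite e (IH _ (predU1 p.1 S')) // => y /=; rewrite e. Qed.

Lemma wfcode_cat S w1 w2 : wfcode S (w1 ++ w2) =
  wfcode S w1 && wfcode (predU (mem (unzip1 w1)) S) w2.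
Proof.
elim: w1 S => [|p w IH] S /=; first by apply: eq_wfcode.
rewrite IH andbA; congr (_ && _); apply: eq_wfcode => y /=.
by rewrite inE orbA; congr orb; rewrite orbC.
Qed.

Lemma wfcode_fcode (S : pred nat) x f : S x -> wfcode S (fcode x f).
Proof.
elim/forest_ind: f x S => // l cs f IH1 IH2 x S Sx.
by rewrite fcode_cons wfcode_cat IH1 //= Sx orbT IH2 //= eqxx.
Qed.

Lemma codeQ_lab t l y : codeQ t l y -> y \in 0 :: flabels t.
Proof. by move/fcode_bound. Qed.

(** A boundary is read before the letter that carries it, and labels are distinct. Filtering the
    letters already read thus leaves exactly the boundary, or nothing when it is 0, which is also
    the default of [last]. *)
Lemma fshape_codeQ t : good_labels (flabels t) -> fshape t (codeQ t).
Proof.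
rewrite /fshape /codeQ; set c := fcode 0 t; rewrite -(unzip1_fcode 0) -/c.
have : wfcode (pred1 0) c by apply: wfcode_fcode.
(* Generalized to a code of which the prefix [w0] has been read. *)
suff H w0 w : good_labels (unzip1 (w0 ++ w)) -> wfcode (predU (mem (unzip1 w0)) (pred1 0)) w ->
   w = mkcode 0 (fun l y => (l, y) \in w0 ++ w) (unzip1 w0) (unzip1 w).
  by move=> wf gc; apply: (H [::]).
elim: w w0 => [|[l b] w IH] w0 //= g /andP[bl wf].
congr (_ :: _); last first.
  have Hu : unzip1 (rcons w0 (l, b)) = rcons (unzip1 w0) l by rewrite /unzip1 map_rcons.
  have := IH (rcons w0 (l, b)); rewrite cat_rcons Hu; apply=> //.
  rewrite -(@eq_wfcode (predU1 l (predU (mem (unzip1 w0)) (pred1 0)))) // => y /=.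
  by rewrite mem_rcons inE orbA.
congr (_, _).
have [u n0] : uniq (unzip1 (w0 ++ (l, b) :: w)) /\ 0 \notin unzip1 (w0 ++ (l, b) :: w) by apply/andP.
have Qb y : ((l, y) \in w0 ++ (l, b) :: w) = (y == b).
  apply/idP/eqP => [|->]; last by rewrite mem_cat inE eqxx orbT.
  move: u; rewrite /unzip1 map_cat /= cat_uniq /= negb_or => /and3P[_ /andP[l0 _] /andP[l1 _]].
  rewrite mem_cat inE => /or3P[h|/eqP[]//|h]; first by rewrite (map_f fst h) in l0.
  by rewrite (map_f fst h) in l1.
rewrite (eq_filter Qb) -/(unzip1 _).
case/orP: bl => [/= bw0|/eqP /= b0]; last first.
  rewrite b0; have -> // : [seq y <- unzip1 w0 | y == 0] = [::].
  apply/eqP; rewrite -[_ == _]negbK -has_filter; apply/hasPn => y yw /=.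
  by apply: contraNneq n0 => <-; rewrite /unzip1 map_cat mem_cat yw.
have uw0 : uniq (unzip1 w0) by move: u; rewrite /unzip1 map_cat cat_uniq; case/andP.
by rewrite (eq_filter (a2 := pred1 b)) // filter_pred1_uniq.
Qed.

(** * Codes of restrictions and graftings *)

Lemma iota_fsize_cons o l cs f : iota o (fsize (NT l cs :: f)) =
  iota o (fsize cs) ++ (o + fsize cs) :: iota (o + fsize cs).+1 (fsize f).
Proof. by rewrite fsize_cons iotaD. Qed.

Lemma flabels_restr P o f :
  flabels (frestr_at P o f) = mask [seq P q | q <- iota o (fsize f)] (flabels f).
Proof.
elim/forest_ind: f o => // l cs f IH1 IH2 o.
rewrite frestr_cons iota_fsize_cons flabels_cons map_cat mask_cat; last first.
  by rewrite size_map size_iota size_flabels.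
by rewrite flabels_cat IH2 -IH1 /=; case: ifP => _ //; rewrite flabels_cons -catA.
Qed.

(* [b] sends each label to the last label kept by [P] up to that point. *)
Fixpoint consistent (P : pred nat) (b : nat -> nat) (o y : nat) (s : seq nat) : Prop :=
  if s is l :: s' then b l = (if P o then l else b y) /\ consistent P b o.+1 l s' else True.

Lemma consistent_cat P b o y s1 s2 : consistent P b o y (s1 ++ s2) <->
  consistent P b o y s1 /\ consistent P b (o + size s1) (last y s1) s2.
Proof.
elim: s1 o y => [|l s1 IH] o y /=; first by rewrite addn0; split=> // -[].
by rewrite IH addSnnS; tauto.
Qed.

(** What is left of the subtree of a kept node still begins after its old boundary; if that boundary
    is deleted, the last kept node up to it, given by [b], takes over. The second conjunct tells
    where the trees to the right start. *)
Lemma fcode_restr P b o y f : consistent P b o y (flabels f) ->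
  fcode (b y) (frestr_at P o f) =
    [seq (p.1, b p.2) | p <- mask [seq P q | q <- iota o (fsize f)] (fcode y f)]
  /\ last (b y) (flabels (frestr_at P o f)) = b (last y (flabels f)).
Proof.
elim/forest_ind: f o y => // l cs f IH1 IH2 o y.
rewrite flabels_cons => /consistent_cat[/IH1[E1 L1] [bl]].
rewrite size_flabels in bl * => /IH2[E2 L2].
rewrite frestr_cons iota_fsize_cons fcode_cons map_cat mask_cat; last first.
  by rewrite size_map size_iota -[size (fcode _ _)](size_map fst) -/(unzip1 _) unzip1_fcode size_flabels.
rewrite map_cat -E1 fcode_cat flabels_cat !last_cat [mask _ (_ :: _)]/=.
case: (P _) bl => bl.
  by rewrite fcode_cons flabels_cons !last_cat -catA /= -E2 -L2 bl.
rewrite /=; by rewrite L1 -bl E2 L2.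
Qed.

Lemma mask_interval (T : Type) i j o (w : seq T) :
  mask [seq (i < q.+1) && (q < j) | q <- iota o (size w)] w = take (j - maxn i o) (drop (i - o) w).
Proof.
elim: w o => //= a w IH o; rewrite IH ltnS.
case: (leqP i o) => io /=.
  have -> : i - o = 0 by lia. have -> : i - o.+1 = 0 by lia.
  rewrite !drop0; case: (ltnP o j) => oj.
    by have -> : j - o = (j - maxn i o.+1).+1 by lia.
  have -> : j - o = 0 by lia. have -> : j - maxn i o.+1 = 0 by lia.
  by rewrite !take0.
have -> : i - o = (i - o.+1).+1 by lia.
by have -> : maxn i o.+1 = i by lia.
Qed.

Lemma flabels_tint i j f : flabels (tint i.+1 j f) = take (j - i) (drop i (flabels f)).
Proof. by rewrite flabels_restr -size_flabels mask_interval maxn0 subn0. Qed.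

Lemma take_mkcode k x Q e s : take k (mkcode x Q e s) = mkcode x Q e (take k s).
Proof. by elim: s k e => [|l s IH] [|k] e //=; rewrite IH. Qed.

Lemma drop_mkcode k x Q e s : drop k (mkcode x Q e s) = mkcode x Q (e ++ take k s) (drop k s).
Proof.
elim: s k e => [|l s IH] [|k] e //=; first by rewrite cats0.
by rewrite IH cat_rcons.
Qed.

(** Blockers inside the interval survive unchanged; a node whose blockers all lie before the
    interval gets the outer boundary [x]. *)
Lemma fcode_tint x Q i j u : good_labels (flabels u) -> fshape u Q ->
  fcode x (tint i.+1 j u) = mkcode x Q [::] (take (j - i) (drop i (flabels u))).
Proof.
case/andP; set s := flabels u => us s0 su.
set s1 := take i s; set s2 := take (j - i) (drop i s); set s3 := drop (j - i) (drop i s).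
have es : s = s1 ++ s2 ++ s3 by rewrite !cat_take_drop.
(* [b] collapses what precedes the interval to [x] and what follows it to the last kept label. *)
pose b y := if y \in s2 then y else if y \in s3 then last x s2 else x.
move: us s0; rewrite es !mem_cat !cat_uniq !negb_or has_cat negb_or.
case/and5P=> _ /andP[/hasPn d12 /hasPn d13] _ /hasPn d23 _ /and3P[n1 n2 n3].
have b0 : b 0 = x by rewrite /b (negbTE n2) (negbTE n3).
have b1 y : y \in s1 -> b y = x.
  by move=> y1; rewrite /b; case: ifP => [/d12/negP//|_]; case: ifP => [/d13/negP//|_].
have b2 y : y \in s2 -> b y = y by rewrite /b => ->.
have b3 y : y \in s3 -> b y = last x s2.
  by move=> y3; rewrite /b y3; case: ifP => // y2; case/negP: (d23 _ y3).
have l1 : b (last 0 s1) = x.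
  by have := mem_last 0 s1; rewrite inE => /orP[/eqP->|/b1].
have l2 : b (last (last 0 s1) s2) = last x s2.
  by case: (s2) b2 => [|y s'] b2 /=; rewrite ?l1 // b2 // mem_last.
have C : consistent (fun p => (i < p.+1) && (p < j)) b 0 0 s.
  have none o y r : (forall q, o <= q < o + size r -> ~~ ((i < q.+1) && (q < j))) ->
      (forall l, l \in r -> b l = b y) -> consistent (fun p => (i < p.+1) && (p < j)) b o y r.
    elim: r o y => //= l r IH o y nP bl; split.
      by rewrite ifN ?bl ?inE ?eqxx //; apply: nP; lia.
    apply: IH => [q hq|k kr]; first by apply: nP; lia.
    by rewrite !bl ?inE ?eqxx ?kr ?orbT.
  have allk o y r : (forall q, o <= q < o + size r -> (i < q.+1) && (q < j)) ->
      (forall l, l \in r -> b l = l) -> consistent (fun p => (i < p.+1) && (p < j)) b o y r.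
    elim: r o y => //= l r IH o y nP bl; split.
      by rewrite ifT ?bl ?inE ?eqxx //; apply: nP; lia.
    apply: IH => [q hq|k kr]; first by apply: nP; lia.
    by rewrite bl ?inE ?kr ?orbT.
  have z1 : size s1 = minn i (size s) by rewrite size_take_min.
  have z2 : size s2 = minn (j - i) (size s - i) by rewrite size_take_min size_drop.
  have z3 : size s3 = size s - i - (j - i) by rewrite !size_drop.
  rewrite es; apply/consistent_cat; split; last (apply/consistent_cat; split).
  - by apply: none => [q|l ls]; [rewrite ?z1 ?z2 ?z3; lia|rewrite b1 ?b0].
  - by apply: allk => [q|l ls]; [rewrite ?z1 ?z2 ?z3; lia|rewrite b2].
  - by apply: none => [q|l ls]; [rewrite ?z1 ?z2 ?z3; lia|rewrite b3 ?l2].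
have := (fcode_restr C).1; rewrite b0 => ->.
rewrite -size_flabels -(unzip1_fcode 0) size_map mask_interval maxn0 subn0.
rewrite su drop_mkcode take_mkcode -/s -/s1 -/s2 cat0s.
(* [d] is the part of [s2] already read. Blockers in [s1] are sent to [x] by [b], so they can be
   forgotten. *)
suff H d r : s2 = d ++ r ->
    [seq (p.1, b p.2) | p <- mkcode 0 Q (s1 ++ d) r] = mkcode x Q d r.
  by rewrite -[s1]cats0; exact: H.
elim: r d => //= l r IH d e2; rewrite rcons_cat IH ?cat_rcons //; congr ((_, _) :: _).
rewrite filter_cat last_cat; have sub : {subset filter (Q l) d <= s2}.
  by move=> y; rewrite mem_filter e2 mem_cat => /andP[_ ->].
case/lastP E: (filter (Q l) d) sub => [|f y] sub /=; last first.
  by rewrite !last_rcons b2 // sub // mem_rcons inE eqxx.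
case/lastP E1: (filter (Q l) s1) => [//|f y]; rewrite last_rcons b1 //.
have : y \in filter (Q l) s1 by rewrite E1 mem_rcons inE eqxx.
by rewrite mem_filter => /andP[].
Qed.

Lemma fshape_tint Q i j u : good_labels (flabels u) -> fshape u Q -> fshape (tint i.+1 j u) Q.
Proof. by move=> gu su; rewrite /fshape (fcode_tint _ _ _ gu su) flabels_tint. Qed.

(** * Grafting and the blockers of the terms of a product *)

Fixpoint gweave (G : nat -> nat -> seq (nat * nat)) p x (w : seq (nat * nat)) :=
  if w is q :: w' then G p x ++ q :: gweave G p.+1 q.1 w' else [::].

Fixpoint lweave (H : nat -> seq nat) p (s : seq nat) :=
  if s is l :: s' then H p ++ l :: lweave H p.+1 s' else [::].

Lemma gweave_cat G p x w1 w2 : gweave G p x (w1 ++ w2) =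
  gweave G p x w1 ++ gweave G (p + size w1) (last x (unzip1 w1)) w2.
Proof.
elim: w1 p x => [|q w1 IH] p x /=; first by rewrite addn0.
by rewrite IH -catA addSnnS.
Qed.

Lemma lweave_cat H p s1 s2 : lweave H p (s1 ++ s2) = lweave H p s1 ++ lweave H (p + size s1) s2.
Proof. by elim: s1 p => [|l s1 IH] p /=; rewrite ?addn0 // IH -catA addSnnS. Qed.

Lemma eq_lweave H H' p s : (forall q, p <= q < p + size s -> H q = H' q) ->
  lweave H p s = lweave H' p s.
Proof.
elim: s p => //= l s IH p e; rewrite e ?IH // => [q hq|]; last by lia.
by apply: e; lia.
Qed.

Lemma flabels_graft_at g p f :
  flabels (fgraft_at g p f) = lweave (fun q => flabels (g q)) p (flabels f).
Proof.
elim/forest_ind: f p => // l cs f IH1 IH2 p.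
rewrite fgraft_cons !flabels_cons flabels_cat IH1 IH2 lweave_cat -catA /=.
by rewrite size_flabels.
Qed.

Lemma last_lweave H p x s : last x (lweave H p s) = last x s.
Proof. by elim: s p x => //= l s IH p x; rewrite last_cat /= IH. Qed.

(** Grafted children are the last ones of their node, so in post-order they come right before it and
    leave its boundary unchanged. Their own starting boundary is the node of [f] read just before,
    or [x] if there is none. *)
Lemma fcode_graft_at g p x f :
  fcode x (fgraft_at g p f) = gweave (fun q y => fcode y (g q)) p x (fcode x f).
Proof.
elim/forest_ind: f p x => // l cs f IH1 IH2 p x.
rewrite fgraft_cons !fcode_cons fcode_cat IH1 IH2 gweave_cat -catA /=.
rewrite flabels_graft_at last_lweave unzip1_fcode.
by rewrite -[size (fcode _ _)](size_map fst) -/(unzip1 _) unzip1_fcode size_flabels.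
Qed.

Definition starQ (A : seq nat) (Qt Qu : nat -> pred nat) (l : nat) : pred nat :=
  fun y => if l \in A then Qt l y else (y \in A) || Qu l y.

(** [A] stands for the labels of [t], [D] for those of [u]; [G p y] is the code, from boundary [y],
    of the forest grafted at position [p], and [H p] its word of labels. *)
Section GraftShape.
Variables (A : seq nat) (D : pred nat) (Qt Qu : nat -> pred nat).
Hypothesis DA : forall y, D y -> y \notin A.
Hypothesis QtD : forall l y, l \in A -> D y -> ~~ Qt l y.
Variables (G : nat -> nat -> seq (nat * nat)) (H : nat -> seq nat).
Hypothesis GH : forall p y, G p y = mkcode y Qu [::] (H p).
Hypothesis HD : forall p, all D (H p).

(** A block is inserted right after a node [x] of [A]. Since all of [A] blocks the labels in [D],
    [x] is the last blocker outside the block, whatever else has been read. *)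
Lemma block_shape p x s0 : x = last 0 s0 -> (s0 == [::]) || (x \in A) ->
  G p x = mkcode 0 (starQ A Qt Qu) s0 (H p).
Proof.
move=> hx xA; rewrite GH; have := HD p; move: (H p) => h.
suff K d r : all D (d ++ r) -> mkcode x Qu d r = mkcode 0 (starQ A Qt Qu) (s0 ++ d) r.
  by move=> hD; rewrite -[s0]cats0; apply: K.
elim: r d => //= l r IH d; rewrite all_cat /= => /and3P[Dd Dl Dr].
rewrite rcons_cat IH; last by rewrite cat_rcons all_cat Dd /= Dl.
congr ((_, _) :: _); rewrite filter_cat last_cat; have lA := negbTE (DA Dl).
have -> : filter (starQ A Qt Qu l) d = filter (Qu l) d.
  apply: eq_in_filter => y yd; rewrite /starQ lA.
  by rewrite (negbTE (DA (allP Dd _ yd))).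
congr last; case/lastP: s0 hx xA {IH} => [//|s' z].
rewrite last_rcons => <-; have -> /= : (rcons s' x == [::]) = false by case: s'.
by move=> xA; rewrite filter_rcons /starQ lA xA last_rcons.
Qed.

(** [s0] is the mixed word already read; its letters in [A] form the prefix read in [t]. The
    inserted letters are in [D] and block no node of [A]. *)
Lemma gweave_shape p x s0 a : x = last 0 s0 -> (s0 == [::]) || (x \in A) ->
  all (predU (mem A) D) s0 -> {subset a <= A} ->
  gweave G p x (mkcode 0 Qt (filter (mem A) s0) a) ++ G (p + size a) (last x a) =
  mkcode 0 (starQ A Qt Qu) s0 (lweave H p a ++ H (p + size a)).
Proof.
elim: a p x s0 => [|l a IH] p x s0 hx xA s0D aA /=.
  by rewrite addn0; apply: block_shape.
have lA : l \in A by apply: aA; rewrite inE eqxx.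
have fH : filter (mem A) (s0 ++ H p) = filter (mem A) s0.
  rewrite filter_cat (_ : filter _ (H p) = [::]) ?cats0 //.
  by apply/eqP; rewrite -[_ == _]negbK -has_filter; apply/hasPn=> y /(allP (HD p))/DA.
have sD : all (predU (mem A) D) (s0 ++ H p).
  by rewrite all_cat s0D; apply/allP=> y /(allP (HD p)) Dy /=; rewrite Dy orbT.
rewrite -!catA /= addnS mkcode_cat -(block_shape p hx xA) /=.
congr (_ ++ (_, last _ _) :: _).
  rewrite -fH -filter_predI; apply: eq_in_filter => y /(allP sD) /=.
  rewrite /starQ lA => /orP[->|Dy]; first by rewrite andbT.
  by rewrite (negbTE (QtD lA Dy)).
have -> : rcons (filter (mem A) s0) l = filter (mem A) (rcons (s0 ++ H p) l).
  by rewrite filter_rcons fH /= lA.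
rewrite -addSn IH // ?last_rcons ?lA ?orbT //.
  by rewrite all_rcons /= lA sD.
by move=> y ya; apply: aA; rewrite inE ya orbT.
Qed.
End GraftShape.

Lemma graft_shape g t (D : pred nat) Qt Qu : fshape t Qt ->
  (forall y, D y -> y \notin flabels t) ->
  (forall l y, l \in flabels t -> D y -> ~~ Qt l y) ->
  (forall p y, fcode y (g p) = mkcode y Qu [::] (flabels (g p))) ->
  (forall p, all D (flabels (g p))) ->
  fshape (fgraft g t) (starQ (flabels t) Qt Qu).
Proof.
move=> st DA QtD gC gD; rewrite /fshape /fgraft fcode_cat fcode_graft_at st.
have := @gweave_shape _ _ _ _ DA QtD _ _ gC gD 0 0 [::] (flabels t).
rewrite add0n flabels_cat flabels_graft_at last_lweave size_flabels /= => -> //.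
Qed.

Lemma gfun_block n C u F p : gfun (blocks n C u) F p = [::] \/
  exists a b, gfun (blocks n C u) F p = tint a.+1 b u.
Proof.
rewrite /gfun /blocks; case: ifP => _; last by left.
move: (index p F) (rcons C n) 0 => k s; elim: s k => [|c s IH] [|k] o /=; try by left.
  by right; exists o, c.
exact: IH.
Qed.

(** The blockers depend neither on the partition nor on the map [f]; a term of the product is
    therefore determined by its word of labels. *)
Lemma star_list_shape t u Qt Qu v :
  good_labels (flabels u) -> fshape t Qt -> fshape u Qu ->
  (forall y, y \in flabels u -> y \notin flabels t) ->
  (forall l y, l \in flabels t -> y \in flabels u -> ~~ Qt l y) ->
  v \in star_list t u -> fshape v (starQ (flabels t) Qt Qu).
Proof.
move=> gu st su DA QtD; rewrite /star_list; case eu: u => [|c u'].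
  rewrite inE => /eqP ->; rewrite /fshape st; apply: eq_mkcode => l lt y _.
  by rewrite /starQ lt.
rewrite -eu => /flatten_mapP[C _ /mapP[F _ ->]] {v}.
apply: (graft_shape (D := mem (flabels u))) => // [p y|p].
  case: (gfun_block (fsize u) C u F p) => [->//|[a [b ->]]].
  by rewrite (fcode_tint _ _ _ gu su) flabels_tint.
case: (gfun_block (fsize u) C u F p) => [->//|[a [b ->]]].
by rewrite flabels_tint; apply/allP=> y /mem_take /mem_drop.
Qed.

(** * Shuffles *)

(** Choosing the number [k] of letters of [c] before each letter of [a] matches the blocks grafted
    at successive nodes, an absent block being an empty chunk. The recursion on first letters is
    [shuffles_cons]. *)
Fixpoint shuffles (a c : seq nat) : seq (seq nat) :=
  if a is x :: a' then
    flatten [seq [seq take k c ++ x :: r | r <- shuffles a' (drop k c)] | k <- iota 0 (size c).+1]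
  else [:: c].

Lemma shuffles_nil a : shuffles a [::] = [:: a].
Proof. by elim: a => //= x a ->. Qed.

Lemma shuffles_split x a c : shuffles (x :: a) c =
  flatten [seq [seq take k c ++ x :: r | r <- shuffles a (drop k c)] | k <- iota 0 (size c).+1].
Proof. by []. Qed.

Arguments shuffles : simpl never.

Lemma shuffles_cons x a y c : shuffles (x :: a) (y :: c) =
  [seq x :: s | s <- shuffles a (y :: c)] ++ [seq y :: s | s <- shuffles (x :: a) c].
Proof.
have E n : iota 0 n.+1 = 0 :: [seq k.+1 | k <- iota 0 n] by rewrite -[X in _ :: X](iotaDl 1).
rewrite !shuffles_split E [size (y :: c)]/=; move: (size c).+1 => m.
rewrite [LHS]/= -[map _ (map succn _)]map_comp map_flatten -[in RHS]map_comp.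
by congr (_ ++ flatten _); apply: eq_map => k; rewrite /= -map_comp.
Qed.

Lemma sum_shuffles_cons (F : seq nat -> nat) x a y c :
  \sum_(s <- shuffles (x :: a) (y :: c)) F s =
  \sum_(s <- shuffles a (y :: c)) F (x :: s) + \sum_(s <- shuffles (x :: a) c) F (y :: s).
Proof. by rewrite shuffles_cons big_cat !big_map. Qed.

Lemma perm_shuffles a c s : s \in shuffles a c -> perm_eq s (a ++ c).
Proof.
elim: a c s => [|x a IH] c s; first by rewrite inE => /eqP->.
rewrite shuffles_split; case/flatten_mapP=> k _ /mapP[r /IH pr ->].
rewrite -[x :: r]cat1s perm_catCA /= perm_cons.
by rewrite (perm_trans (perm_cat (perm_refl _) pr)) // perm_catCA cat_take_drop.
Qed.

(** Equality of multisets is tested on functions with values in [nat], which reduces the bookkeeping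
    to linear arithmetic. The words starting with the first letter of [a], [b] or [c] are matched by
    the induction hypothesis for that word. *)
Lemma shufflesA (phi : seq nat -> nat) a b c :
  \sum_(s <- shuffles a b) \sum_(r <- shuffles s c) phi r =
  \sum_(s <- shuffles b c) \sum_(r <- shuffles a s) phi r.
Proof.
elim: a b c phi => [|x a IHa] b c phi.
  by rewrite big_seq1; under [RHS]eq_bigr do rewrite big_seq1.
elim: b c phi => [|y b IHb] c phi; first by rewrite shuffles_nil !big_seq1.
elim: c phi => [|z c IHc] phi.
  by rewrite shuffles_nil big_seq1; under eq_bigr do rewrite shuffles_nil big_seq1.
rewrite !sum_shuffles_cons.
under [X in X + _ = _]eq_bigr do rewrite sum_shuffles_cons.
under [X in _ + X = _]eq_bigr do rewrite sum_shuffles_cons.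
under [X in _ = X + _]eq_bigr do rewrite sum_shuffles_cons.
under [X in _ = _ + X]eq_bigr do rewrite sum_shuffles_cons.
rewrite !big_split /=.
have := IHa (y :: b) (z :: c) (fun r => phi (x :: r)).
rewrite [X in _ = X]sum_shuffles_cons.
have := IHb (z :: c) (fun r => phi (y :: r)).
have := IHc (fun r => phi (z :: r)).
rewrite [X in X = _]sum_shuffles_cons.
lia.
Qed.

(** Cutting a shuffle cuts both words, and each half shuffles the corresponding halves. The
    induction looks at the first letter of the left half, the empty left half being counted
    apart. *)
Lemma shuffles_deconcat (phi : seq nat -> seq nat -> nat) a c :
  \sum_(s <- shuffles a c) \sum_(0 <= k < (size s).+1) phi (take k s) (drop k s) =
  \sum_(0 <= i < (size a).+1) \sum_(0 <= j < (size c).+1)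
    \sum_(s1 <- shuffles (take i a) (take j c)) \sum_(s2 <- shuffles (drop i a) (drop j c)) phi s1 s2.
Proof.
elim: a c phi => [|x a IHa] c phi.
  by rewrite big_seq1 big_nat1; apply: eq_bigr => j _; rewrite !big_seq1.
elim: c phi => [|y c IHc] phi.
  by rewrite shuffles_nil big_seq1; apply: eq_bigr => i _; rewrite big_nat1 !shuffles_nil !big_seq1.
have D z (s : seq nat) : \sum_(0 <= k < (size (z :: s)).+1) phi (take k (z :: s)) (drop k (z :: s)) =
   phi [::] (z :: s) + \sum_(0 <= k < (size s).+1) phi (z :: take k s) (drop k s).
  by rewrite big_nat_recl.
have R (F : nat -> nat) n : \sum_(0 <= k < n.+1) F k = F 0 + \sum_(0 <= k < n) F k.+1.
  by rewrite big_nat_recl.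
(* [T] is the summand on the right. [U] and [V] are the summands for the pairs [a], [y :: c] and
   [x :: a], [c], with [x], resp. [y], put back in front of the left half. *)
pose T i j := \sum_(s1 <- shuffles (take i (x :: a)) (take j (y :: c)))
  \sum_(s2 <- shuffles (drop i (x :: a)) (drop j (y :: c))) phi s1 s2.
pose U i j := \sum_(s1 <- shuffles (take i a) (take j (y :: c)))
  \sum_(s2 <- shuffles (drop i a) (drop j (y :: c))) phi (x :: s1) s2.
pose V i j := \sum_(s1 <- shuffles (take i (x :: a)) (take j c))
  \sum_(s2 <- shuffles (drop i (x :: a)) (drop j c)) phi (y :: s1) s2.
have T00 : T 0 0 = \sum_(s <- shuffles (x :: a) (y :: c)) phi [::] s by rewrite /T big_seq1.
have T0 j : T 0 j.+1 = V 0 j by rewrite /T /V !big_seq1.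
have T1 i : T i.+1 0 = U i 0 by rewrite /T /U !take0 !shuffles_nil !big_seq1.
have TUV i j : T i.+1 j.+1 = U i j.+1 + V i.+1 j.
  by rewrite /T /U /V [take i.+1 _]/= [take j.+1 _]/= sum_shuffles_cons.
have EU := IHa (y :: c) (fun s1 s2 => phi (x :: s1) s2).
have EV := IHc (fun s1 s2 => phi (y :: s1) s2).
rewrite -/(U _ _) in EU; rewrite -/(V _ _) in EV.
transitivity (\sum_(0 <= i < (size a).+2) \sum_(0 <= j < (size c).+2) T i j); last by [].
transitivity (T 0 0 + \sum_(0 <= i < (size a).+1) \sum_(0 <= j < (size c).+2) U i j +
    \sum_(0 <= i < (size a).+2) \sum_(0 <= j < (size c).+1) V i j).
  rewrite -EU -EV T00 !sum_shuffles_cons.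
  under eq_bigr do rewrite D; under [X in _ + X = _]eq_bigr do rewrite D.
  by rewrite !big_split /=; lia.
rewrite [RHS]R [X in _ = X + _]R [X in _ + X = _]R.
under [X in _ + X + _ = _]eq_bigr do rewrite R.
under [X in _ = _ + _ + X]eq_bigr do rewrite R T1.
under [X in _ = _ + _ + X]eq_bigr do under eq_bigr do rewrite TUV.
under [X in _ = _ + X + _]eq_bigr do rewrite T0.
under [X in _ = _ + _ + X]eq_bigr do rewrite big_split /=.
rewrite !big_split /=; lia.
Qed.

(** [cutseq], [pick_block] and [lgraft] transcribe [blocks], [gfun] and [fgraft] to words of labels.
    The start [i] allows an induction in which the first [i] letters are already placed. *)
Definition cutseq (c : seq nat) (i : nat) (C : seq nat) : seq (seq nat) :=
  pairmap (fun a b => take (b - a) (drop a c)) i (rcons C (size c)).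

Definition pick_block (bl : seq (seq nat)) (F : seq nat) (p : nat) : seq nat :=
  if p \in F then nth [::] bl (index p F) else [::].

Definition lgraft (H : nat -> seq nat) (p : nat) (A : seq nat) : seq nat :=
  lweave H p A ++ H (p + size A).

Lemma lgraft_cons H p l A : lgraft H p (l :: A) = H p ++ l :: lgraft H p.+1 A.
Proof. by rewrite /lgraft /= -catA addSnnS. Qed.

Lemma eq_lgraft H H' p A : (forall q, p <= q -> H q = H' q) -> lgraft H p A = lgraft H' p A.
Proof.
elim: A p => [|l A IH] p e; first by rewrite /lgraft /= e ?leq_addr.
by rewrite !lgraft_cons e // (IH p.+1) // => q /ltnW; exact: e.
Qed.

Lemma lgraft_nil H p A : (forall q, p <= q -> H q = [::]) -> lgraft H p A = A.
Proof.
elim: A p => [|l A IH] p e; first by rewrite /lgraft /= e ?leq_addr.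
by rewrite lgraft_cons e //= (IH p.+1) // => q /ltnW; exact: e.
Qed.

Lemma mem_subseqs (s F : seq nat) x : F \in subseqs s -> x \in F -> x \in s.
Proof.
elim: s F => [|y s IH] F /=; first by rewrite inE => /eqP->.
rewrite mem_cat inE => /orP[/mapP[F' /IH hF ->]|/IH hF /hF ->]; last by rewrite orbT.
by rewrite inE => /orP[->//|/hF ->]; rewrite orbT.
Qed.

Lemma sum_subseqs_first (psi : seq nat -> nat) i m :
  \sum_(C <- subseqs (iota i m)) psi C =
  psi [::] + \sum_(0 <= k < m) \sum_(C <- subseqs (iota (i + k).+1 (m - k.+1))) psi (i + k :: C).
Proof.
elim: m i => [|m IH] i; first by rewrite big_nil big_seq1 addn0.
rewrite /= big_cat big_map big_nat_recl // IH addn0 subn1 /= addnCA; congr (_ + (_ + _)).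
by apply: eq_bigr => k _; rewrite addSnnS.
Qed.

Lemma sum_subseqs_nil (psi : seq nat -> nat) (s : seq nat) :
  \sum_(F <- subseqs s | size F == 0) psi F = psi [::].
Proof.
elim: s => [|x s IH]; first by rewrite big_mkcond big_seq1.
by rewrite /= big_cat big_map big_pred0 // IH.
Qed.

(* A partition of [c] into blocks placed at increasing gaps of [A] is the same
   as a shuffle: the block of each gap of [A] may be empty. *)
Lemma sum_cuts_shuffles (phi : seq nat -> nat) c A i p : i < size c ->
  \sum_(C <- subseqs (iota i.+1 (size c - i).-1))
    \sum_(F <- subseqs (iota p (size A).+1) | size F == (size C).+1)
      phi (lgraft (pick_block (cutseq c i C) F) p A) =
  \sum_(s <- shuffles A (drop i c)) phi s.
Proof.
elim: A i p phi => [|l A IH] i p phi hi.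
  rewrite sum_subseqs_first [X in _ + X]big1 ?addn0; last first.
    by move=> k _; rewrite big1 // => C _; rewrite !big_cons big_nil.
  rewrite /= !big_cons !big_nil /= !addn0; congr phi.
  by rewrite /lgraft /pick_block /= addn0 inE !eqxx /= take_oversize ?size_drop.
have notp F : F \in subseqs (iota p.+1 (size A).+1) -> forall q, q <= p -> q \notin F.
  by move=> hF q hq; apply/negP => /(mem_subseqs hF); rewrite mem_iota; lia.
set r := subseqs (iota p.+1 (size A).+1) in notp.
have er : subseqs (iota p (size (l :: A)).+1) = [seq p :: y | y <- r] ++ r by [].
rewrite er {er}; under eq_bigr do rewrite big_cat big_map /=.
rewrite big_split /= addnC.
(* No block at gap [p]: the shuffle starts with [l], after an empty chunk. *)
have E0 : \sum_(C <- subseqs (iota i.+1 (size c - i).-1)) \sum_(F <- r | size F == (size C).+1)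
      phi (lgraft (pick_block (cutseq c i C) F) p (l :: A)) =
    \sum_(s <- shuffles A (drop i c)) phi (l :: s).
  rewrite -(IH i p.+1 (fun s => phi (l :: s)) hi); apply: eq_bigr => C _.
  rewrite big_seq_cond [RHS]big_seq_cond; apply: eq_bigr => F /andP[hF _].
  by rewrite lgraft_cons {1}/pick_block (negbTE (notp _ hF _ _)).
(* A block at gap [p] is the first one; the remaining blocks and positions concern the gaps from
   [p.+1] on. *)
have pbS b bl F A' : F \in r ->
    lgraft (pick_block (b :: bl) (p :: F)) p (l :: A') = b ++ l :: lgraft (pick_block bl F) p.+1 A'.
  move=> hF; rewrite lgraft_cons {1}/pick_block inE eqxx /= eqxx; congr (_ ++ _ :: _).
  apply: eq_lgraft => q hq; rewrite /pick_block inE /=.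
  have qp : (q == p) = false by apply/eqP; lia.
  by rewrite [p == q]eq_sym qp.
rewrite {}E0 shuffles_split big_flatten big_map size_drop.
have -> : (size c - i).+1 = (size c - i).-1.+2 by lia.
set m := (size c - i).-1; rewrite -[iota 0 _]/(index_iota 0 m.+2) big_nat_recl //.
rewrite big_map take0 drop0; congr (_ + _).
(* If [C] is empty, the first block is all of [drop i c], the largest chunk; otherwise it ends at
   the first cut [i.+1 + k]. *)
rewrite big_nat_recr //= addnC sum_subseqs_first; congr (_ + _).
  rewrite big_map (_ : drop m.+1 (drop i c) = [::]); last first.
    by rewrite drop_oversize // size_drop; lia.
  rewrite shuffles_nil big_seq1 big_mkcond /=.
  under eq_bigr do rewrite eqSS; rewrite -big_mkcond /=.
  rewrite (eq_bigl (fun F => size F == 0)) // sum_subseqs_nil.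
  rewrite /cutseq /= pbS; last by rewrite /r; elim: (iota _ _) => //= x s hs; rewrite mem_cat hs orbT.
  by rewrite (lgraft_nil _ (H := pick_block _ _)) // (_ : size c - i = m.+1) // /m; lia.
apply: eq_big_nat => k /andP[_ km].
have hk : i.+1 + k < size c by move: km; rewrite /m; lia.
rewrite big_map drop_drop (_ : k.+1 + i = i.+1 + k); last by lia.
rewrite -(IH _ p.+1 (fun s => phi (take k.+1 (drop i c) ++ l :: s)) hk).
rewrite (_ : m - k.+1 = (size c - (i.+1 + k)).-1); last by rewrite /m; lia.
apply: eq_bigr => C _; rewrite big_seq_cond [RHS]big_seq_cond.
apply: eq_big => [F|F /andP[hF _]]; first by rewrite /= eqSS.
by rewrite /cutseq /= pbS // (_ : i.+1 + k - i = k.+1) //; lia.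
Qed.

Lemma flabels_blocks C u :
  map flabels (blocks (fsize u) C u) = cutseq (flabels u) 0 C.
Proof.
rewrite /blocks /cutseq size_flabels; elim: (rcons _ _) 0 => //= b s IH i.
by rewrite flabels_tint IH.
Qed.

Lemma flabels_gfun bl F p : flabels (gfun bl F p) = pick_block (map flabels bl) F p.
Proof.
rewrite /gfun /pick_block; case: ifP => // _.
by elim: bl (index p F) => [|b bl IH] [|k] //=.
Qed.

Lemma sum_star_list_flabels (phi : seq nat -> nat) t u :
  \sum_(v <- star_list t u) phi (flabels v) =
  \sum_(s <- shuffles (flabels t) (flabels u)) phi s.
Proof.
rewrite /star_list; case eu: u => [|c u']; first by rewrite shuffles_nil !big_seq1.
rewrite -eu; have u0 : 0 < size (flabels u).
  by rewrite size_flabels lt0n fsize_eq0 eu.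
have := sum_cuts_shuffles phi (flabels t) 0 u0; rewrite drop0 subn0 => <-.
rewrite big_flatten big_map size_flabels; apply: eq_bigr => C _.
rewrite big_map big_filter size_flabels; apply: eq_bigr => F _.
rewrite /fgraft flabels_cat flabels_graft_at flabels_gfun /lgraft flabels_blocks size_flabels.
by congr (phi (_ ++ _)); apply: eq_lweave => q _; rewrite flabels_gfun flabels_blocks.
Qed.

(** Indicator functions recover the multiplicities. *)
Lemma perm_of_sum (T : eqType) (s1 s2 : seq T) :
  (forall phi : T -> nat, \sum_(x <- s1) phi x = \sum_(x <- s2) phi x) -> perm_eq s1 s2.
Proof.
move=> e; apply/allP=> x _ /=.
have C s : count_mem x s = \sum_(y <- s) (y == x).
  by rewrite -sum1_count big_mkcond; apply: eq_bigr => y _ /=; case: eqP.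
by rewrite !C e.
Qed.

Lemma perm_star_list_flabels t u :
  perm_eq (map flabels (star_list t u)) (shuffles (flabels t) (flabels u)).
Proof. by apply: perm_of_sum => phi; rewrite big_map sum_star_list_flabels. Qed.

(** Injectivity is only asked across the two lists, which is what [fshape_inj] provides; within [s1]
    it follows by passing through an element of [s2] with the same image. *)
Lemma perm_of_map (T U : eqType) (f : T -> U) (s1 s2 : seq T) :
  {in s1 & s2, forall x y, f x = f y -> x = y} ->
  perm_eq (map f s1) (map f s2) -> perm_eq s1 s2.
Proof.
move=> fI pf; have m := perm_mem pf.
have fI1 : {in s1 &, injective f}.
  move=> x y xs ys e; have : f x \in map f s2 by rewrite -m map_f.
  by case/mapP=> z zs ez; rewrite (fI _ _ xs zs ez) (fI _ _ ys zs) // -e.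
have sub : {subset s2 <= s1}.
  by move=> y ys; have := map_f f ys; rewrite -m => /mapP[x xs e]; rewrite -(fI _ _ xs ys).
apply/allP=> x; rewrite mem_cat => xs /=.
have x1 : x \in s1 by case/orP: xs => // /sub.
have cnt s : {subset s <= s1} -> count_mem x s = count_mem (f x) (map f s).
  by move=> ss; rewrite count_map; apply: eq_in_count => y /ss ys /=; rewrite (inj_in_eq fI1).
by rewrite !cnt //; apply/eqP; move/permP: pf; apply.
Qed.

(** * Associativity and compatibility for trees *)

Lemma star_list_flabels t u v : v \in star_list t u ->
  flabels v \in shuffles (flabels t) (flabels u).
Proof. by move=> vs; rewrite -(perm_mem (perm_star_list_flabels t u)) map_f. Qed.

Lemma perm_flabels_star t u v : v \in star_list t u ->
  perm_eq (flabels v) (flabels t ++ flabels u).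
Proof. by move/star_list_flabels/perm_shuffles. Qed.

Lemma good_labels_cat s1 s2 : good_labels (s1 ++ s2) ->
  [/\ good_labels s1, good_labels s2, forall y, y \in s1 -> y \notin s2 & forall y, y \in s2 -> y \notin s1].
Proof.
rewrite /good_labels cat_uniq mem_cat negb_or => /andP[/and3P[-> /hasPn h ->] /andP[-> ->]].
by split=> // y y1; apply/negP => y2; case/negP: (h _ y2).
Qed.

Lemma good_labels_neq0 s y : good_labels s -> y \in s -> y != 0.
Proof. by case/andP=> _ h ys; apply: contraNneq h => <-. Qed.

Lemma good_labels_perm s1 s2 : perm_eq s1 s2 -> good_labels s1 = good_labels s2.
Proof. by move=> p; rewrite /good_labels (perm_uniq p) (perm_mem p). Qed.

Lemma good_labels_flabels_tint i j t : good_labels (flabels t) -> good_labels (flabels (tint i.+1 j t)).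
Proof.
case/andP=> u n0; rewrite flabels_tint /good_labels take_uniq ?drop_uniq //=.
by apply: contra n0 => /mem_take /mem_drop.
Qed.

Lemma sub_flabels_tint i j t : {subset flabels (tint i.+1 j t) <= flabels t}.
Proof. by rewrite flabels_tint => y /mem_take /mem_drop. Qed.

Lemma fshape_eq v Q Q' : fshape v Q ->
  {in flabels v &, forall l y, Q l y = Q' l y} -> fshape v Q'.
Proof. by move=> sv e; rewrite /fshape sv; apply: eq_mkcode => l lv y yv; apply: e. Qed.

Lemma codeQ_notin t l y : good_labels (flabels t) -> y != 0 -> y \notin flabels t -> ~~ codeQ t l y.
Proof. by move=> gt y0 yt; apply/negP => /codeQ_lab; rewrite inE (negbTE y0) (negbTE yt). Qed.

(** The words of labels agree by [shufflesA], and two terms with the same word are equal because the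
    blockers agree. *)
Lemma star_listA t u w : good_labels (flabels t ++ flabels u ++ flabels w) ->
  perm_eq (flatten [seq star_list x w | x <- star_list t u])
          (flatten [seq star_list t y | y <- star_list u w]).
Proof.
move=> g; apply: (perm_of_map (f := flabels)); last first.
  apply: perm_of_sum => phi; rewrite !big_map !big_flatten !big_map.
  under eq_bigr do rewrite sum_star_list_flabels.
  under [RHS]eq_bigr do rewrite sum_star_list_flabels.
  rewrite (sum_star_list_flabels (fun s => \sum_(r <- shuffles s _) phi r)).
  rewrite (sum_star_list_flabels (fun s => \sum_(r <- shuffles _ s) phi r)).
  exact: shufflesA.
have [gt guw tuw uwt] := good_labels_cat g.
have [gu gw uw wu] := good_labels_cat guw.
have gtu : good_labels (flabels t ++ flabels u) by rewrite catA in g; case: (good_labels_cat g).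
have [_ _ tu ut] := good_labels_cat gtu.
move=> v v' /flatten_mapP[x xs vs] /flatten_mapP[y ys vs'] e.
have px z : (z \in flabels x) = (z \in flabels t) || (z \in flabels u).
  by rewrite (perm_mem (perm_flabels_star xs)) mem_cat.
have py z : (z \in flabels y) = (z \in flabels u) || (z \in flabels w).
  by rewrite (perm_mem (perm_flabels_star ys)) mem_cat.
have sx := star_list_shape gu (fshape_codeQ gt) (fshape_codeQ gu) ut
  (fun l z _ zu => codeQ_notin l gt (good_labels_neq0 gu zu) (ut _ zu)) xs.
have sy := star_list_shape gw (fshape_codeQ gu) (fshape_codeQ gw) wu
  (fun l z _ zw => codeQ_notin l gu (good_labels_neq0 gw zw) (wu _ zw)) ys.
have wt z : z \in flabels w -> z \notin flabels t.
  by move=> zw; apply: uwt; rewrite mem_cat zw orbT.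
have sv : fshape v (starQ (flabels x) (starQ (flabels t) (codeQ t) (codeQ u)) (codeQ w)).
  apply: star_list_shape vs => // [|z zw|l z _ zw]; first exact: fshape_codeQ.
    by rewrite px negb_or wt ?wu.
  rewrite /starQ; case: ifP => _; first by rewrite codeQ_notin ?wt ?(good_labels_neq0 gw).
  by rewrite negb_or wt //= codeQ_notin ?wu ?(good_labels_neq0 gw).
have gy : good_labels (flabels y) by rewrite (good_labels_perm (perm_flabels_star ys)).
have yt z : z \in flabels y -> z \notin flabels t by rewrite py -mem_cat; apply: uwt.
have sv' : fshape v' (starQ (flabels t) (codeQ t) (starQ (flabels u) (codeQ u) (codeQ w))).
  apply: star_list_shape vs' => // [|l z _ zy]; first exact: fshape_codeQ.
  by rewrite codeQ_notin ?yt ?(good_labels_neq0 gy).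
apply: (fshape_inj _ sv) e.
  rewrite (good_labels_perm (perm_flabels_star vs)) (good_labels_perm (s2 := (flabels t ++ flabels u) ++ flabels w)) -?catA //.
  by rewrite catA perm_cat2r perm_flabels_star.
(* On both sides a node of [t] keeps its blockers, a node of [u] is also blocked by all of [t], and
   any other by all of [t] and [u]. *)
apply: fshape_eq sv' _ => l z _ _; rewrite /starQ !px.
by case: (l \in flabels t) => //=; case: (l \in flabels u); rewrite ?orbA.
Qed.

(** Restriction to intervals keeps blockers, so the product of two intervals has the blockers of the
    full product. This handles both tensor factors in the compatibility. *)
Lemma star_sub_shape t u i j k m v : good_labels (flabels t ++ flabels u) ->
  v \in star_list (tint i.+1 j t) (tint k.+1 m u) ->
  fshape v (starQ (flabels t) (codeQ t) (codeQ u)).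
Proof.
move=> g vs; have [gt gu tu ut] := good_labels_cat g.
have sv : fshape v (starQ (flabels (tint i.+1 j t)) (codeQ t) (codeQ u)).
  apply: star_list_shape vs.
  - exact: good_labels_flabels_tint.
  - exact: fshape_tint gt (fshape_codeQ gt).
  - exact: fshape_tint gu (fshape_codeQ gu).
  - by move=> y /sub_flabels_tint /ut; apply: contra => /sub_flabels_tint.
  - move=> l y _ /sub_flabels_tint yu.
    by rewrite codeQ_notin ?ut ?(good_labels_neq0 gu).
apply: fshape_eq sv _ => l y.
have sub z : z \in flabels v -> (z \in flabels (tint i.+1 j t)) = (z \in flabels t).
  rewrite (perm_mem (perm_flabels_star vs)) mem_cat => /orP[zt|/sub_flabels_tint/ut zt].
    by rewrite zt (sub_flabels_tint zt).
  by rewrite (negbTE zt); apply: contraNF zt => /sub_flabels_tint.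
by move=> lv yv; rewrite /starQ !sub.
Qed.

Lemma tint_all t : good_labels (flabels t) -> tint 1 (fsize t) t = t.
Proof.
move=> gt; have el : flabels (tint 1 (fsize t) t) = flabels t.
  by rewrite flabels_tint drop0 subn0 -size_flabels take_size.
by apply: (fshape_inj _ (fshape_tint _ _ gt (fshape_codeQ gt)) (fshape_codeQ gt)); rewrite ?el.
Qed.

Lemma star_list_shape_codeQ t u v : good_labels (flabels t ++ flabels u) ->
  v \in star_list t u -> fshape v (starQ (flabels t) (codeQ t) (codeQ u)).
Proof.
move=> g vs; have [gt gu _ _] := good_labels_cat g.
by apply: (@star_sub_shape t u 0 (fsize t) 0 (fsize u)); rewrite ?tint_all.
Qed.

(** The coproduct before standardization. *)
Definition cuts (t : forest) : seq (forest * forest) :=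
  [seq (tint 1 k t, tint k.+1 (fsize t) t) | k <- iota 0 (fsize t).+1].

Lemma flabels_prefix k t : flabels (tint 1 k t) = take k (flabels t).
Proof. by rewrite flabels_tint drop0 subn0. Qed.

Lemma flabels_suffix k t : flabels (tint k.+1 (fsize t) t) = drop k (flabels t).
Proof. by rewrite flabels_tint -size_flabels -size_drop take_size. Qed.

(** The pairs of words agree by [shuffles_deconcat]. In each factor, an interval of a term of the
    product and a product of intervals have the same blockers. *)
Lemma star_list_cuts t u : good_labels (flabels t ++ flabels u) ->
  perm_eq (flatten [seq cuts v | v <- star_list t u])
          (flatten [seq [seq (x, y) | x <- star_list p.1 q.1, y <- star_list p.2 q.2]
                   | p <- cuts t, q <- cuts u]).
Proof.
move=> g; have [gt gu tu ut] := good_labels_cat g.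
apply: (perm_of_map (f := fun p => (flabels p.1, flabels p.2))); last first.
  apply: perm_of_sum => phi; rewrite [LHS]big_map [RHS]big_map [LHS]big_flatten [RHS]big_flatten.
  rewrite [LHS]big_map [RHS]big_allpairs_dep /=.
  under eq_bigr do (rewrite big_map -size_flabels;
    under eq_bigr do rewrite flabels_prefix size_flabels flabels_suffix).
  rewrite (sum_star_list_flabels (fun s => \sum_(k <- iota 0 (size s).+1) phi (take k s, drop k s))).
  rewrite [LHS](shuffles_deconcat (fun a b => phi (a, b))) !size_flabels big_map.
  apply: eq_bigr => i _; rewrite big_map; apply: eq_bigr => j _; rewrite big_allpairs_dep /=.
  rewrite -!flabels_prefix -!flabels_suffix.
  under [RHS]eq_bigr => x _ do rewrite (sum_star_list_flabels (fun s => phi (flabels x, s))).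
  by rewrite (sum_star_list_flabels (fun r => \sum_(s <- shuffles _ _) phi (r, s))).
move=> [a b] [a' b'] /flatten_mapP[v vs /mapP[k _ [-> ->]]].
case/flattenP=> _ /allpairsP[[p q] [/mapP[i _ ->] /mapP[j _ ->] ->]].
case/allpairsPdep=> x [y [/= xs ys [-> ->]]] [e1 e2].
have gv : good_labels (flabels v) by rewrite (good_labels_perm (perm_flabels_star vs)).
have sv := star_list_shape_codeQ g vs.
have gtint c d := @good_labels_flabels_tint c d _ gv.
congr (_, _).
  exact: fshape_inj (gtint _ _) (fshape_tint _ _ gv sv) (star_sub_shape g xs) e1.
exact: fshape_inj (gtint _ _) (fshape_tint _ _ gv sv) (star_sub_shape g ys) e2.
Qed.

(** The empty word has a single shuffle with the labels of [u], and the blockers identify the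
    corresponding term. *)
Lemma star_list_1l u : good_labels (flabels u) -> star_list [::] u = [:: u].
Proof.
move=> gu; apply: perm_small_eq => //; apply: (perm_of_map (f := flabels)).
  move=> v x vs; rewrite inE => /eqP-> e.
  have gv : good_labels (flabels v) by rewrite e.
  apply: (fshape_inj gv _ (fshape_codeQ gu) e).
  exact: (@star_list_shape_codeQ [::]).
exact: perm_star_list_flabels.
Qed.

Lemma tint_tint i j k m n p t : good_labels (flabels t) ->
  take (j - i) (drop i (take (m - k) (drop k (flabels t)))) = take (p - n) (drop n (flabels t)) ->
  tint i.+1 j (tint k.+1 m t) = tint n.+1 p t.
Proof.
move=> gt e; have s1 := fshape_tint k m gt (fshape_codeQ gt).
have g1 := @good_labels_flabels_tint k m _ gt.
apply: (fshape_inj (good_labels_flabels_tint _ _ g1) (fshape_tint _ _ g1 s1) (fshape_tint _ _ gt (fshape_codeQ gt))).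
by rewrite !flabels_tint.
Qed.

(** * Relabelling and standardization *)

Lemma flabels_frelabel g f : flabels (frelabel g f) = map g (flabels f).
Proof.
elim/forest_ind: f => // l cs f IH1 IH2.
by rewrite frelabel_cons !flabels_cons map_cat IH1 IH2.
Qed.

Lemma fsize_frelabel g f : fsize (frelabel g f) = fsize f.
Proof. by rewrite -!size_flabels flabels_frelabel size_map. Qed.

Lemma frelabel_comp g h f : frelabel g (frelabel h f) = frelabel (g \o h) f.
Proof. by elim/forest_ind: f => // l cs f IH1 IH2; rewrite !frelabel_cons IH1 IH2. Qed.

Lemma eq_in_frelabel g h f : {in flabels f, g =1 h} -> frelabel g f = frelabel h f.
Proof.
elim/forest_ind: f => // l cs f IH1 IH2; rewrite flabels_cons => e.
rewrite !frelabel_cons e ?IH1 ?IH2 // => [y yf|y yc|]; rewrite ?e //.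
- by rewrite mem_cat inE yf !orbT.
- by rewrite mem_cat yc.
- by rewrite mem_cat inE eqxx !orbT.
Qed.

Lemma frelabel_id g f : {in flabels f, g =1 id} -> frelabel g f = f.
Proof.
move/eq_in_frelabel->; elim/forest_ind: f => // l cs f IH1 IH2.
by rewrite frelabel_cons IH1 IH2.
Qed.

Lemma frelabel_cat g f1 f2 : frelabel g (f1 ++ f2) = frelabel g f1 ++ frelabel g f2.
Proof. exact: map_cat. Qed.

Lemma frelabel_restr g P o f : frelabel g (frestr_at P o f) = frestr_at P o (frelabel g f).
Proof.
elim/forest_ind: f o => // l cs f IH1 IH2 o.
rewrite frelabel_cons !frestr_cons fsize_frelabel frelabel_cat IH2 -IH1.
by case: ifP.
Qed.

Lemma frelabel_tint g i j f : frelabel g (tint i j f) = tint i j (frelabel g f).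
Proof. exact: frelabel_restr. Qed.

Lemma frelabel_graft_at h g o f :
  frelabel h (fgraft_at g o f) = fgraft_at (frelabel h \o g) o (frelabel h f).
Proof.
elim/forest_ind: f o => // l cs f IH1 IH2 o.
by rewrite fgraft_cons !frelabel_cons fgraft_cons fsize_frelabel frelabel_cat IH1 IH2.
Qed.

Lemma eq_fgraft_at g h o f : g =1 h -> fgraft_at g o f = fgraft_at h o f.
Proof.
move=> e; elim/forest_ind: f o => // l cs f IH1 IH2 o.
by rewrite !fgraft_cons IH1 IH2 e.
Qed.

Lemma frelabel_gfun h bl F p :
  frelabel h (gfun bl F p) = gfun (map (frelabel h) bl) F p.
Proof.
rewrite /gfun; case: ifP => // _.
by elim: bl (index p F) => [|b bl IH] [|k] //=.
Qed.

Lemma map_blocks h n C u :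
  map (frelabel h) (blocks n C u) = blocks n C (frelabel h u).
Proof.
rewrite /blocks; elim: (rcons C n) 0 => //= b s IH i.
by rewrite frelabel_tint IH.
Qed.

Lemma star_list_frelabel g t u :
  star_list (frelabel g t) (frelabel g u) = map (frelabel g) (star_list t u).
Proof.
have [->//|u0] := eqVneq u [::].
have E x y : y != [::] -> star_list x y = flatten
    [seq [seq fgraft (gfun (blocks (fsize y) C y) F) x
         | F <- [seq F <- subseqs (iota 0 (fsize x).+1) | size F == (size C).+1]]
    | C <- subseqs (iota 1 (fsize y).-1)] by case: y.
rewrite !E //; last by rewrite -fsize_eq0 fsize_frelabel fsize_eq0.
rewrite !fsize_frelabel map_flatten; congr flatten.
rewrite -[RHS]map_comp; apply: eq_map => C /=.
rewrite -[RHS]map_comp; apply: eq_map => F /=.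
rewrite /fgraft frelabel_cat frelabel_graft_at fsize_frelabel frelabel_gfun map_blocks.
by congr (_ ++ _); apply: eq_fgraft_at => p /=; rewrite frelabel_gfun map_blocks.
Qed.

Lemma fsize_std t : fsize (std t) = fsize t.
Proof. exact: fsize_frelabel. Qed.

Lemma flabels_std t : flabels (std t) = [seq count (fun x => x <= l) (flabels t) | l <- flabels t].
Proof. exact: flabels_frelabel. Qed.

Lemma std_frelabel g t :
  {in flabels t &, forall x y, (g x <= g y) = (x <= y)} -> std (frelabel g t) = std t.
Proof.
move=> gm; rewrite /std frelabel_comp; apply: eq_in_frelabel => l lt /=.
by rewrite flabels_frelabel count_map; apply: eq_in_count => x xt /=; rewrite gm.
Qed.

Lemma count_le_mono (s : seq nat) :
  {in s &, forall x y, (count (fun z => z <= x) s <= count (fun z => z <= y) s) = (x <= y)}.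
Proof.
move=> x y xs ys; case: (leqP x y) => xy.
  by apply: sub_count => z /= zx; exact: leq_trans zx xy.
apply/negbTE; rewrite -ltnNge.
have -> : count (fun z => z <= x) s = count (fun z => z <= y) s + count (fun z => y < z <= x) s.
  rewrite -count_predUI [X in _ + X](eq_count (a2 := pred0)) ?count_pred0 ?addn0.
    by apply: eq_count => z /=; lia.
  by move=> z /=; lia.
by rewrite -[ltnLHS]addn0 ltn_add2l -has_count; apply/hasP; exists x; rewrite ?xy ?leqnn.
Qed.

(** Ranks compare as the labels do, by [count_le_mono], so a prior standardization is invisible. *)
Lemma std_tint_std i j t : std (tint i.+1 j (std t)) = std (tint i.+1 j t).
Proof.
rewrite {2}/std -frelabel_tint std_frelabel // => x y xt yt.
by rewrite count_le_mono //; apply: sub_flabels_tint; eassumption.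
Qed.

Lemma good_labels_ntreeb t : ntreeb t -> good_labels (flabels t).
Proof.
move=> nt; rewrite (good_labels_perm nt) /good_labels iota_uniq mem_iota //.
Qed.

Lemma mem_ntreeb t l : ntreeb t -> (l \in flabels t) = (0 < l <= fsize t).
Proof. by move=> nt; rewrite (perm_mem nt) mem_iota add1n ltnS. Qed.

Lemma std_id t : ntreeb t -> std t = t.
Proof.
move=> nt; apply: frelabel_id => l; rewrite (mem_ntreeb _ nt) (permP nt) => /andP[l0 ln].
have -> : fsize t = l + (fsize t - l) by lia.
rewrite iotaD count_cat (@eq_in_count _ _ predT) ?count_predT ?size_iota.
  rewrite (@eq_in_count _ _ pred0) ?count_pred0 ?addn0 // => x.
  by rewrite mem_iota /=; lia.
by move=> x; rewrite mem_iota /=; lia.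
Qed.

Lemma ntreeb_std t : uniq (flabels t) -> ntreeb (std t).
Proof.
move=> ut; rewrite /ntreeb fsize_std flabels_std -size_flabels.
set s := flabels t in ut *; set c := fun l => count (fun x => x <= l) s.
have us : uniq (map c s).
  rewrite map_inj_in_uniq // => x y xs ys e; apply/eqP; rewrite eqn_leq.
  have e' : count (fun z => z <= x) s = count (fun z => z <= y) s by exact: e.
  by rewrite -(count_le_mono xs ys) -(count_le_mono ys xs) e' leqnn.
have sub : {subset map c s <= iota 1 (size s)}.
  move=> _ /mapP[l ls ->]; rewrite mem_iota add1n ltnS count_size andbT -has_count.
  by apply/hasP; exists l => /=.
have sz : size (iota 1 (size s)) <= size (map c s) by rewrite size_map size_iota.
have [_ e] := uniq_min_size us sub sz.
by apply: uniq_perm => //; rewrite iota_uniq.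
Qed.

(** All terms have the same set of labels, so one rank function [c] standardizes them all. The
    labels of [t] being smaller, [c] is the rank in [t] on [t], and the rank in [u] shifted by the
    degree of [t] on [u]. *)
Lemma map_std_star_list t u : good_labels (flabels t ++ flabels u) ->
  {in flabels t & flabels u, forall x y, x < y} ->
  map std (star_list t u) = star (std t) (std u).
Proof.
move=> g tu; pose c l := count (fun x => x <= l) (flabels t ++ flabels u).
have -> : map std (star_list t u) = map (frelabel c) (star_list t u).
  apply/eq_in_map => v vs; apply: eq_in_frelabel => l _.
  by apply/permP/perm_flabels_star.
rewrite -star_list_frelabel /star fsize_std /shift frelabel_comp; congr star_list.
  apply: eq_in_frelabel => l lt; rewrite /c count_cat [X in _ + X](@eq_in_count _ _ pred0).
    by rewrite count_pred0 addn0.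
  by move=> x xu /=; rewrite leqNgt tu.
apply: eq_in_frelabel => l lu; rewrite /c count_cat /= [X in X + _](@eq_in_count _ _ predT).
  by rewrite count_predT size_flabels.
by move=> x xt /=; rewrite ltnW ?tu.
Qed.

Lemma flabels_shift m u : flabels (shift m u) = map (addn m) (flabels u).
Proof. exact: flabels_frelabel. Qed.

Lemma perm_ntreeb_cat t u : ntreeb t -> ntreeb u ->
  perm_eq (flabels t ++ flabels (shift (fsize t) u)) (iota 1 (fsize t + fsize u)).
Proof.
move=> nt nu; rewrite iotaD [1 + _]addnC iotaDl flabels_shift.
by apply: perm_cat => //; apply: perm_map.
Qed.

Lemma star_ntreeb t w v : ntreeb t -> ntreeb w -> v \in star t w ->
  ntreeb v /\ fsize v = fsize t + fsize w.
Proof.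
move=> nt nw vs; have p := perm_trans (perm_flabels_star vs) (perm_ntreeb_cat nt nw).
have e : fsize v = fsize t + fsize w by rewrite -size_flabels (perm_size p) size_iota.
by rewrite /ntreeb e.
Qed.

Lemma star_1r t : star t [::] = [:: t].
Proof. by []. Qed.

Lemma star_1l t : ntreeb t -> star [::] t = [:: t].
Proof.
move=> nt; rewrite /star /shift frelabel_id; first by apply/star_list_1l/good_labels_ntreeb.
by move=> l _; rewrite /= add0n.
Qed.

(** * The coproduct indexed by cut points *)

Definition std_tint (t : forest) (i j : nat) : forest := std (tint i.+1 j t).

Lemma cop_std_tint t : cop t = [seq (std_tint t 0 k, std_tint t k (fsize t)) | k <- iota 0 (fsize t).+1].
Proof. by []. Qed.

Lemma fsize_std_tint t i j : fsize (std_tint t i j) = minn (j - i) (fsize t - i).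
Proof. by rewrite fsize_std -size_flabels flabels_tint size_take_min size_drop size_flabels. Qed.

Lemma ntreeb_std_tint t i j : ntreeb t -> ntreeb (std_tint t i j).
Proof.
by move=> /good_labels_ntreeb gt; apply: ntreeb_std; case/andP: (good_labels_flabels_tint i j gt).
Qed.

Lemma std_tint_all t : ntreeb t -> std_tint t 0 (fsize t) = t.
Proof. by move=> nt; rewrite /std_tint tint_all ?std_id ?good_labels_ntreeb. Qed.

Lemma std_tint_nil t i : std_tint t i i = [::].
Proof. by apply/eqP; rewrite -fsize_eq0 fsize_std_tint subnn min0n. Qed.

Lemma std_tint_std_tint t i j k m : ntreeb t -> m <= j - i ->
  std_tint (std_tint t i j) k m = std_tint t (i + k) (i + m).
Proof.
move=> /good_labels_ntreeb gt mj; rewrite /std_tint std_tint_std; congr std.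
apply: tint_tint => //; rewrite subnDl.
case: (leqP k m) => km; last by rewrite (_ : m - k = 0) ?take0 //; lia.
have -> : j - i = (j - i - k) + k by lia.
by rewrite -take_drop take_takel ?drop_drop 1?[k + i]addnC //; lia.
Qed.

Lemma cop_std_tint_sub t i j : ntreeb t -> i <= j <= fsize t ->
  cop (std_tint t i j) = [seq (std_tint t i (i + k), std_tint t (i + k) j) | k <- iota 0 (j - i).+1].
Proof.
move=> nt /andP[ij jn]; have e : fsize (std_tint t i j) = j - i by rewrite fsize_std_tint; lia.
rewrite cop_std_tint e; apply/eq_in_map => k; rewrite mem_iota => /andP[_ hk].
by rewrite !std_tint_std_tint ?addn0 ?subnKC //; lia.
Qed.

Lemma mem_cop t x : x \in cop t ->
  exists2 k, k <= fsize t & x = (std_tint t 0 k, std_tint t k (fsize t)).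
Proof. by rewrite cop_std_tint => /mapP[k]; rewrite mem_iota => /andP[_ hk] ->; exists k. Qed.

Lemma cop_ntreeb t x : ntreeb t -> x \in cop t -> ntreeb x.1 /\ ntreeb x.2.
Proof. by move=> nt /mem_cop[k _ ->]; rewrite !ntreeb_std_tint. Qed.

(** * Associativity, compatibility and coassociativity as equalities of sums *)

Section Sums.
Variable M : nmodType.
Local Open Scope ring_scope.

Lemma starA_sum (phi : forest -> M) t u w : ntreeb t -> ntreeb u -> ntreeb w ->
  \sum_(x <- star t u) \sum_(z <- star x w) phi z =
  \sum_(y <- star u w) \sum_(z <- star t y) phi z.
Proof.
(* Shifting once and for all makes the labels disjoint. The left bracketing shifts [w] by the degree
   of a term of [t ⋆ u]; in the right one, the shift by the degree of [t] commutes with the product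
   of [u] and [w]. *)
move=> nt nu nw; pose u' := shift (fsize t) u; pose w' := shift (fsize t + fsize u) w.
have ew : w' = shift (fsize t) (shift (fsize u) w).
  by rewrite /shift frelabel_comp; apply: eq_in_frelabel => l _; rewrite /= addnA.
have g : good_labels (flabels t ++ flabels u' ++ flabels w').
  rewrite catA (good_labels_perm (s2 := iota 1 (fsize t + fsize u + fsize w))).
    by rewrite /good_labels iota_uniq mem_iota.
  rewrite iotaD (perm_trans _ (perm_cat (perm_ntreeb_cat nt nu) (perm_refl _))) //.
  by rewrite perm_cat2l [(1 + _)%N]addnC iotaDl flabels_shift; apply: perm_map.
transitivity (\sum_(z <- flatten [seq star_list x w' | x <- star_list t u']) phi z).
  rewrite big_flatten big_map; apply: eq_big_seq => x xs.
  by have [_ e] := star_ntreeb nt nu xs; rewrite /star e.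
rewrite (perm_big _ (star_listA g)) big_flatten big_map ew star_list_frelabel big_map.
by [].
Qed.

Lemma cop_star_sum (phi : forest * forest -> M) t w : ntreeb t -> ntreeb w ->
  \sum_(v <- star t w) \sum_(x <- cop v) phi x =
  \sum_(p <- cop t) \sum_(q <- cop w)
    \sum_(a <- star p.1 q.1) \sum_(b <- star p.2 q.2) phi (a, b).
Proof.
move=> nt nw; pose w' := shift (fsize t) w.
have g : good_labels (flabels t ++ flabels w').
  by rewrite (good_labels_perm (perm_ntreeb_cat nt nw)) /good_labels iota_uniq mem_iota.
pose sp (p : forest * forest) := (std p.1, std p.2).
have ec v : cop v = map sp (cuts v) by rewrite /cuts -map_comp.
transitivity (\sum_(p <- flatten [seq cuts v | v <- star_list t w']) phi (sp p)).
  by rewrite big_flatten big_map; apply: eq_bigr => v _; rewrite ec big_map.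
rewrite (perm_big _ (star_list_cuts g)) big_flatten big_allpairs_dep [cop t]ec [RHS]big_map.
apply: eq_big_seq => p /mapP[i _ ->]; rewrite ec /cuts fsize_frelabel 2![RHS]big_map [LHS]big_map.
apply: eq_bigr => j _; rewrite big_allpairs_dep /= /shift -!frelabel_tint.
(* Standardization erases the difference between the shift by the degree of [t] and that by the
   degree of its interval. *)
have S a b c d : [seq std x | x <- star_list (tint a.+1 b t) (frelabel (addn (fsize t)) (tint c.+1 d w))] =
    star (std (tint a.+1 b t)) (std (tint c.+1 d w)).
  rewrite map_std_star_list.
  - by congr star; apply: std_frelabel => x y _ _; rewrite leq_add2l.
  - rewrite frelabel_tint; have [gt gw tw wt] := good_labels_cat g.
    rewrite /good_labels cat_uniq mem_cat negb_or.
    have /andP[-> ->] := good_labels_flabels_tint a b gt.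
    have /andP[-> ->] := good_labels_flabels_tint c d gw; rewrite !andbT /=.
    by apply/hasPn => y /sub_flabels_tint /wt; apply: contra => /sub_flabels_tint.
  move=> x y /sub_flabels_tint; rewrite (mem_ntreeb _ nt) flabels_frelabel => /andP[_ hx].
  case/mapP=> z /sub_flabels_tint; rewrite (mem_ntreeb _ nw) => hz ->; lia.
by rewrite -!S big_map; apply: eq_bigr => x _; rewrite big_map.
Qed.

Lemma sum_triangle (F : nat -> nat -> M) n :
  \sum_(0 <= k < n.+1) \sum_(0 <= j < k.+1) F j k =
  \sum_(0 <= j < n.+1) \sum_(0 <= i < (n - j).+1) F j (j + i)%N.
Proof.
elim: n => [|n IH]; first by rewrite !big_nat1.
rewrite big_nat_recr //= IH [X in _ + X = _]big_nat_recr //= [RHS]big_nat_recr //=.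
rewrite subnn big_nat1 addn0 addrA; congr (_ + _); rewrite -big_split /=.
apply: eq_big_nat => j /andP[_ hj]; rewrite subSn // [RHS]big_nat_recr //=.
by congr (_ + F _ _); lia.
Qed.

(** Both sides run over the pairs of cut points [j <= k], with the three intervals they delimit. *)
Lemma copA_sum (phi : forest -> forest -> forest -> M) t : ntreeb t ->
  \sum_(x <- cop t) \sum_(y <- cop x.1) phi y.1 y.2 x.2 =
  \sum_(x <- cop t) \sum_(y <- cop x.2) phi x.1 y.1 y.2.
Proof.
move=> nt; rewrite cop_std_tint !big_map.
have := sum_triangle (fun j k => phi (std_tint t 0 j) (std_tint t j k) (std_tint t k (fsize t))) (fsize t).
rewrite /index_iota !subn0 => H; etransitivity; last (etransitivity; first exact: H).
  apply: eq_big_seq => k; rewrite mem_iota => /andP[_ hk].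
  by rewrite (@cop_std_tint_sub t 0 k) // subn0 big_map.
apply: eq_big_seq => k; rewrite mem_iota => /andP[_ hk].
by rewrite (@cop_std_tint_sub t k (fsize t)) ?leqnn ?andbT // big_map subn0.
Qed.
End Sums.

(** Since [F S t] consults [S] only in smaller degree, iterating more times than the degree of [t]
    gives a stable value, independent of the initial [d]. *)
Lemma fixpoint_fsize (T : Type) (d : T) (F : (forest -> T) -> forest -> T) :
  (forall S S' t, (forall u, fsize u < fsize t -> S u = S' u) -> F S t = F S' t) ->
  exists S, forall t, S t = F S t.
Proof.
move=> Fl; exists (fun t => iter (fsize t).+1 F (fun=> d) t) => t.
rewrite iterS; apply: (Fl) => u.
have H n m v : fsize v < n -> fsize v < m -> iter n F (fun=> d) v = iter m F (fun=> d) v.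
  elim: n m v => [//|n IH] [//|m] v; rewrite !ltnS !iterS => hn hm.
  by apply: (Fl) => x hx; apply: IH; apply: leq_trans hx _.
by move=> hu; apply: H.
Qed.

(** * Linear combinations and the antipode *)

Section Hopf.
Variable K : fieldType.
Local Open Scope ring_scope.

Definition eval (T : Type) (v : seq (K * T)) (phi : T -> K) : K :=
  \sum_(p <- v) p.1 * phi p.2.

(** Coefficients are evaluations at indicators. Testing against all linear functionals turns
    identities between formal combinations into identities between sums. *)
Lemma veq_eval (T : eqType) (v w : seq (K * T)) :
  (forall phi, eval v phi = eval w phi) -> veq v w.
Proof.
have E u (x : T) : coef u x = eval u (fun y => (y == x)%:R).
  by rewrite /coef big_mkcond; apply: eq_bigr => p _; case: eqP; rewrite ?mulr1 ?mulr0.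
by move=> e x; rewrite !E.
Qed.

Lemma eq_eval (T : eqType) (v : seq (K * T)) phi psi :
  (forall p, p \in v -> phi p.2 = psi p.2) -> eval v phi = eval v psi.
Proof. by move=> e; apply: eq_big_seq => p /e ->. Qed.

Lemma eval_tb (t : forest) phi : eval (tb K t) phi = phi t.
Proof. by rewrite /eval big_seq1 mul1r. Qed.

Lemma eval_flatten (I T : Type) (s : seq I) (f : I -> seq (K * T)) phi :
  eval (flatten [seq f i | i <- s]) phi = \sum_(i <- s) eval (f i) phi.
Proof. by rewrite /eval big_flatten big_map. Qed.

Lemma eval_scale (T : Type) (c : K) (s : seq T) phi :
  eval [seq (c, x) | x <- s] phi = c * \sum_(x <- s) phi x.
Proof. by rewrite /eval big_map mulr_sumr. Qed.

Lemma eval_sum (T I : Type) (v : seq (K * T)) (s : seq I) (F : I -> T -> K) :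
  eval v (fun a => \sum_(i <- s) F i a) = \sum_(i <- s) eval v (F i).
Proof. by rewrite /eval exchange_big; apply: eq_bigr => p _; rewrite mulr_sumr. Qed.

Lemma eval_mull (T : Type) (v : seq (K * T)) (c : K) phi :
  eval v (fun a => c * phi a) = c * eval v phi.
Proof. by rewrite /eval mulr_sumr; apply: eq_bigr => p _; rewrite mulrCA. Qed.

Lemma eval_vstar v w phi :
  eval (vstar v w) phi = eval v (fun a => eval w (fun b => \sum_(x <- star a b) phi x)).
Proof.
rewrite /eval big_flatten big_allpairs_dep; apply: eq_bigr => p _.
rewrite mulr_sumr; apply: eq_bigr => q _.
by rewrite big_map mulrA mulr_sumr.
Qed.

Lemma eval_vcop v phi :
  eval (vcop v) phi = eval v (fun t => \sum_(x <- cop t) phi x).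
Proof. by rewrite eval_flatten; apply: eq_bigr => p _; rewrite eval_scale. Qed.

Lemma eval_tstar v w phi : eval (tstar v w) phi =
  eval v (fun p => eval w (fun q =>
    \sum_(x <- star p.1 q.1) \sum_(y <- star p.2 q.2) phi (x, y))).
Proof.
rewrite /eval big_flatten big_allpairs_dep; apply: eq_bigr => p _.
rewrite mulr_sumr; apply: eq_bigr => q _.
rewrite big_allpairs_dep mulrA mulr_sumr; apply: eq_bigr => x _.
by rewrite mulr_sumr.
Qed.

Lemma eps_fsize t : eps K t = (fsize t == 0%N)%:R.
Proof. by rewrite fsize_eq0. Qed.

Lemma counit_r_sum t (phi : forest -> K) : ntreeb t ->
  \sum_(x <- cop t) eps K x.2 * phi x.1 = phi t.
Proof.
move=> nt; rewrite cop_std_tint big_map -[iota _ _]/(index_iota 0 (fsize t).+1).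
rewrite big_nat_recr //= big_nat big1 ?add0r ?std_tint_nil ?std_tint_all ?eqxx ?mul1r //.
move=> k /andP[_ hk]; rewrite eps_fsize fsize_std_tint minnn.
by rewrite (_ : (_ == _) = false) ?mul0r //; apply/eqP; lia.
Qed.

Lemma counit_l_sum t (phi : forest -> K) : ntreeb t ->
  \sum_(x <- cop t) eps K x.1 * phi x.2 = phi t.
Proof.
move=> nt; rewrite cop_std_tint big_map -[iota _ _]/(index_iota 0 (fsize t).+1).
rewrite big_nat_recl //= big_nat big1 ?addr0 ?std_tint_nil ?std_tint_all ?eqxx ?mul1r //.
move=> k /andP[_ hk]; rewrite eps_fsize fsize_std_tint !subn0.
by rewrite (_ : (_ == _) = false) ?mul0r //; apply/eqP; lia.
Qed.

Definition vopp (v : seq (K * forest)) : seq (K * forest) := [seq (- p.1, p.2) | p <- v].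

Lemma eval_vopp v phi : eval (vopp v) phi = - eval v phi.
Proof. by rewrite /eval big_map -sumrN; apply: eq_bigr => p _; rewrite mulNr. Qed.

(** Formal combinations may list arbitrary forests, while the identities for [star] need correctly
    labelled ones; every listed element counts, even with coefficient zero. *)
Definition supported (v : seq (K * forest)) : bool := all (fun p => ntreeb p.2) v.

Lemma supported_vstar v w : supported v -> supported w -> supported (vstar v w).
Proof.
move=> /allP sv /allP sw; apply/allP=> p /flattenP[_ /allpairsP[[a b] [/= av bw ->]]].
by case/mapP=> x /(star_ntreeb (sv _ av) (sw _ bw))[nx _] ->.
Qed.

Lemma supported_tb t : ntreeb t -> supported (tb K t).
Proof. by rewrite /supported /= andbT. Qed.

Lemma supported_vopp v : supported (vopp v) = supported v.
Proof. by rewrite /supported all_map. Qed.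

Lemma supported_flatten (I : eqType) (s : seq I) f :
  (forall i, i \in s -> supported (f i)) -> supported (flatten [seq f i | i <- s]).
Proof.
by move=> sf; apply/allP=> p /flatten_mapP[i /sf /allP]; apply.
Qed.

Lemma left_antipode : exists S : forest -> seq (K * forest),
  (forall t, ntreeb t -> supported (S t)) /\
  (forall t phi, ntreeb t -> eval (antip_l S t) phi = eps K t * phi [::]).
Proof.
(* The term [k = fsize t] of the convolution is [S t ⋆ ⊙], that is [S t]; solving for it gives the
   recursion. *)
pose F (S : forest -> seq (K * forest)) t := if t == [::] then tb K [::] else
  flatten [seq vopp (vstar (S (std_tint t 0 k)) (tb K (std_tint t k (fsize t)))) | k <- iota 0 (fsize t)].
have [|S SF] := @fixpoint_fsize _ [::] F.
  move=> S S' t e; rewrite /F; case: eqP => // _; congr flatten.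
  apply/eq_in_map => k; rewrite mem_iota => /andP[_ hk].
  by rewrite e // fsize_std_tint; lia.
exists S; split=> [t|t phi nt].
  have [n] := ubnP (fsize t); elim: n t => // n IH t hn nt.
  rewrite SF /F; case: eqP => // _; apply: supported_flatten => k.
  rewrite mem_iota => /andP[_ hk]; rewrite supported_vopp supported_vstar //.
    by apply: IH; rewrite ?ntreeb_std_tint ?fsize_std_tint //; lia.
  by rewrite supported_tb ?ntreeb_std_tint.
rewrite eval_flatten cop_std_tint big_map -[iota _ _]/(index_iota 0 (fsize t).+1) /=.
rewrite big_nat_recr //= std_tint_nil std_tint_all // [X in _ + X]eval_vstar.
under eq_eval => a _ do rewrite eval_tb star_1r big_seq1.
rewrite [S t]SF /F eps_fsize fsize_eq0; case: eqP => [->|_].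
  by rewrite big_geq // add0r eval_tb mul1r.
rewrite eval_flatten mul0r /index_iota subn0 -big_split big1 // => k _.
by rewrite eval_vopp /= subrr.
Qed.

Lemma right_antipode : exists S : forest -> seq (K * forest),
  (forall t, ntreeb t -> supported (S t)) /\
  (forall t phi, ntreeb t -> eval (antip_r S t) phi = eps K t * phi [::]).
Proof.
(* Here the isolated term is [k = 0], namely [⊙ ⋆ S t], so the other cuts are indexed by [k.+1]. *)
pose F (S : forest -> seq (K * forest)) t := if t == [::] then tb K [::] else
  flatten [seq vopp (vstar (tb K (std_tint t 0 k.+1)) (S (std_tint t k.+1 (fsize t)))) | k <- iota 0 (fsize t)].
have [|S SF] := @fixpoint_fsize _ [::] F.
  move=> S S' t e; rewrite /F; case: eqP => // _; congr flatten.
  apply/eq_in_map => k; rewrite mem_iota => /andP[_ hk].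
  by rewrite e // fsize_std_tint; lia.
have supp t : ntreeb t -> supported (S t).
  have [n] := ubnP (fsize t); elim: n t => // n IH t hn nt.
  rewrite SF /F; case: eqP => // _; apply: supported_flatten => k.
  rewrite mem_iota => /andP[_ hk]; rewrite supported_vopp supported_vstar //.
    by rewrite supported_tb ?ntreeb_std_tint.
  by apply: IH; rewrite ?ntreeb_std_tint ?fsize_std_tint //; lia.
exists S; split=> // t phi nt.
rewrite eval_flatten cop_std_tint big_map -[iota _ _]/(index_iota 0 (fsize t).+1) /=.
rewrite big_nat_recl //= std_tint_nil std_tint_all // [X in X + _]eval_vstar eval_tb.
under eq_eval => p pS do rewrite star_1l ?(allP (supp t nt)) // big_seq1.
rewrite [S t]SF /F eps_fsize fsize_eq0; case: eqP => [->|_].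
  by rewrite big_geq // addr0 eval_tb mul1r.
rewrite eval_flatten mul0r /index_iota subn0 -big_split big1 // => k _.
by rewrite eval_vopp /= addNr.
Qed.

(** A left and a right convolution inverse of the identity coincide: both are compared with the
    triple convolution of [S], the identity and [S']. *)
Lemma antipode_unique S S' :
  (forall t, ntreeb t -> supported (S t)) -> (forall t, ntreeb t -> supported (S' t)) ->
  (forall t phi, ntreeb t -> eval (antip_l S t) phi = eps K t * phi [::]) ->
  (forall t phi, ntreeb t -> eval (antip_r S' t) phi = eps K t * phi [::]) ->
  forall t phi, ntreeb t -> eval (S t) phi = eval (S' t) phi.
Proof.
move=> sS sS' HS HS' t phi nt.
pose st f a b : K := \sum_(x <- star a b) f x.
have HL u psi : ntreeb u -> \sum_(x <- cop u) eval (S x.1) (fun a => st psi a x.2) = eps K u * psi [::].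
  move=> nu; rewrite -HS // eval_flatten; apply: eq_bigr => x _.
  by rewrite eval_vstar; apply: eq_bigr => p _; rewrite eval_tb.
have HR u psi : ntreeb u -> \sum_(x <- cop u) eval (S' x.2) (st psi x.1) = eps K u * psi [::].
  move=> nu; rewrite -HS' // eval_flatten; apply: eq_bigr => x _.
  by rewrite eval_vstar eval_tb.
rewrite -(counit_r_sum (fun u => eval (S u) phi) nt) -[RHS](counit_l_sum (fun u => eval (S' u) phi) nt).
(* [X a b c] evaluates [phi] on [(S a ⋆ b) ⋆ S' c]. *)
pose X a b c := eval (S a) (fun p => eval (S' c) (fun q => st (fun y => st phi y q) p b)).
transitivity (\sum_(x <- cop t) \sum_(y <- cop x.2) X x.1 y.1 y.2).
  apply: eq_big_seq => x xt; have [n1 n2] := cop_ntreeb nt xt.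
  rewrite -eval_mull.
  transitivity (eval (S x.1) (fun p => \sum_(y <- cop x.2) eval (S' y.2) (st (st phi p) y.1))).
    apply: eq_eval => p _; rewrite HR //; congr (_ * _).
    by rewrite /st star_1r big_seq1.
  rewrite eval_sum; apply: eq_big_seq => y yx; have [m1 m2] := cop_ntreeb n2 yx.
  apply: eq_eval => p pS; apply: eq_eval => q qS.
  by rewrite /st starA_sum ?(allP (sS _ n1) _ pS) ?(allP (sS' _ m2) _ qS) ?m1.
rewrite -copA_sum //; apply: eq_big_seq => x xt; have [n1 n2] := cop_ntreeb nt xt.
transitivity (\sum_(y <- cop x.1)
    eval (S y.1) (fun p => st (fun r => eval (S' x.2) (fun q => st phi r q)) p y.2)).
  by apply: eq_bigr => y _; apply: eq_eval => p _; rewrite /st eval_sum.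
rewrite HL //; congr (_ * _); apply: eq_eval => q qS.
by rewrite /st star_1l ?big_seq1 // (allP (sS' _ n2)).
Qed.

Lemma antipode_exists : exists S : forest -> seq (K * forest),
  [/\ forall t, ntreeb t -> supported (S t),
      forall t phi, ntreeb t -> eval (antip_l S t) phi = eps K t * phi [::] &
      forall t phi, ntreeb t -> eval (antip_r S t) phi = eps K t * phi [::]].
Proof.
have [S [sS HS]] := left_antipode; have [S' [sS' HS']] := right_antipode.
exists S; split=> // t phi nt; rewrite -HS' // !eval_flatten.
apply: eq_big_seq => x xt; have [_ n2] := cop_ntreeb nt xt.
by rewrite !eval_vstar !eval_tb (antipode_unique sS sS' HS HS').
Qed.
End Hopf.

Local Open Scope ring_scope.

Theorem theorem4p3 (K : fieldType) :
  (* closure: ⋆ and Δ_s stay inside K[T[∞]] *)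
  (forall t w : forest, ntreeb t -> ntreeb w -> all ntreeb (star t w)) /\
  (forall t : forest, ntreeb t -> all (fun x => ntreeb x.1 && ntreeb x.2) (cop t)) /\
  (* grading *)
  (forall t w : forest, ntreeb t -> ntreeb w ->
      all (fun x => fsize x == (fsize t + fsize w)%N) (star t w)) /\
  (forall t : forest, ntreeb t ->
      all (fun x => (fsize x.1 + fsize x.2 == fsize t)%N) (cop t)) /\
  (* associativity and unit *)
  (forall t u w : forest, ntreeb t -> ntreeb u -> ntreeb w ->
      veq (vstar (vstar (tb K t) (tb K u)) (tb K w))
          (vstar (tb K t) (vstar (tb K u) (tb K w)))) /\
  (forall t : forest, ntreeb t ->
      veq (vstar (tb K [::]) (tb K t)) (tb K t) /\
      veq (vstar (tb K t) (tb K [::])) (tb K t)) /\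
  (* coassociativity and counit *)
  (forall t : forest, ntreeb t -> veq (cop_left K t) (cop_right K t)) /\
  (forall t : forest, ntreeb t ->
      veq (counit_r K t) (tb K t) /\ veq (counit_l K t) (tb K t)) /\
  (* compatibility: Δ_s and ε are algebra morphisms *)
  (forall t w : forest, ntreeb t -> ntreeb w ->
      veq (vcop (vstar (tb K t) (tb K w))) (tstar (vcop (tb K t)) (vcop (tb K w)))) /\
  veq (vcop (tb K [::])) [:: (1, ([::], [::]))] /\
  (forall t w : forest, ntreeb t -> ntreeb w ->
      \sum_(x <- star t w) eps K x = eps K t * eps K w) /\
  (* existence of an antipode *)
  (exists S : forest -> seq (K * forest),
      (forall t : forest, ntreeb t -> all (fun p => ntreeb p.2) (S t)) /\
      (forall t : forest, ntreeb t ->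
          veq (antip_l S t) [:: (eps K t, [::])] /\
          veq (antip_r S t) [:: (eps K t, [::])])).
Proof.
split; first by move=> t w nt nw; apply/allP=> x /(star_ntreeb nt nw)[].
split; first by move=> t nt; apply/allP=> x /(cop_ntreeb nt)[-> ->].
split.
  by move=> t w nt nw; apply/allP=> x /(star_ntreeb nt nw)[_ ->].
split.
  move=> t nt; apply/allP=> x /mem_cop[k hk ->] /=; rewrite !fsize_std_tint; apply/eqP; lia.
split.
  move=> t u w nt nu nw; apply: veq_eval => phi.
  rewrite !eval_vstar !eval_tb eval_vstar !eval_tb -starA_sum //.
  by apply: eq_bigr => x _; rewrite eval_tb.
split.
  move=> t nt; split; apply: veq_eval => phi; rewrite eval_vstar !eval_tb.
    by rewrite star_1l // big_seq1.
  by rewrite star_1r big_seq1.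
split.
  move=> t nt; apply: veq_eval => phi; rewrite !eval_flatten.
  transitivity (\sum_(x <- cop t) \sum_(y <- cop x.1) phi (y.1, y.2, x.2)).
    by apply: eq_bigr => x _; rewrite /eval [LHS]big_map; apply: eq_bigr => y _; rewrite mul1r.
  rewrite (copA_sum (fun a b c => phi (a, b, c)) nt).
  by apply: eq_bigr => x _; rewrite /eval [RHS]big_map; apply: eq_bigr => y _; rewrite mul1r.
split.
  move=> t nt; split; apply: veq_eval => phi; rewrite eval_tb /eval big_map.
    exact: counit_r_sum.
  exact: counit_l_sum.
split.
  move=> t w nt nw; apply: veq_eval => phi.
  rewrite eval_vcop eval_vstar !eval_tb cop_star_sum // eval_tstar eval_vcop eval_tb.
  by apply: eq_bigr => p _; rewrite eval_vcop eval_tb.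
split; first by apply: veq_eval => phi; rewrite eval_vcop eval_tb.
split.
  move=> t w nt nw; rewrite !eps_fsize -natrM mulnb.
  have E x : x \in star t w -> eps K x = ((fsize t == 0) && (fsize w == 0))%N%:R.
    by move=> /(star_ntreeb nt nw)[_ e]; rewrite eps_fsize e addn_eq0.
  (* Unless both factors are [⊙], every term of the product has positive degree and both sides
     vanish. *)
  rewrite (eq_big_seq _ E) !fsize_eq0; case: eqP nt => [->|] nt; last by rewrite big1.
  case: eqP nw => [->|] nw; last by rewrite big1.
  by rewrite star_1r big_seq1.
have [S [sS HL HR]] := antipode_exists K; exists S; split=> // t nt.
by split; apply: veq_eval => phi; rewrite ?HL ?HR // /eval big_seq1.
Qed.
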